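(* Let $\mathcal{B}=\coprod_{g\ge 0}B_g$ and $\mathcal{M}=\coprod_{g\ge 0}\Gamma_{g,1}$ be the braided monoidal categories of braid groups and of mapping class groups. The nongeometric embeddings $\phi:B_g\to\Gamma_{g,1}$, $\sigma_i\mapsto\beta_i$, extend to a braided monoidal functor $\Phi:\mathcal{B}\to\mathcal{M}$ (identity on objects, equal to $\phi$ on $\hom_{\mathcal{B}}(g,g)=B_g$ for every $g$).
   Context: $\Gamma_{g,1}$ is the mapping class group (isotopy classes of orientation-preserving self-homeomorphisms fixing the boundary pointwise) of the compact orientable surface $S_{g,1}$ of genus $g$ with one boundary component. $\pi_1S_{g,1}$ (base point on the boundary) is free on standard generators $x_1,y_1,\dots,x_g,y_g$, and $\Gamma_{g,1}$ is identified with the group of automorphisms of this free group fixing the boundary word $[y_1,x_1]\cdots[y_g,x_g]$, where $[y,x]=yxy^{-1}x^{-1}$. Automorphisms act on the right: in a product $fg$, $f$ is applied first; likewise in braid groups a product is a stacking from top to bottom, and in both categories the product $fg$ is the composite ''$f$ followed by $g$''. $\mathcal{M}$ has as objects the nonnegative integers, $\hom(g,g)=\Gamma_{g,1}$, and no morphisms between distinct objects. Its monoidal structure is $g\otimes h=g+h$ on objects and on morphisms the F-product $\Gamma_{g,1}\times\Gamma_{h,1}\to\Gamma_{g+h,1}$ induced by gluing $S_{g,1}$ and $S_{h,1}$ to a pair of pants and extending by the identity; on automorphisms it is the free product (the second factor acting on $x_{g+1},y_{g+1},\dots,x_{g+h},y_{g+h}$). Its braiding $\beta_{r,s}:r\otimes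 s\to s\otimes r$ is the element of $\Gamma_{r+s,1}$ given by $$x_j\mapsto Qx_{s+j}Q^{-1},\ y_j\mapsto Qy_{s+j}Q^{-1}\ (1\le j\le r),\qquad x_{r+j}\mapsto x_j,\ y_{r+j}\mapsto y_j\ (1\le j\le s),$$ where $Q=[y_1,x_1]\cdots[y_s,x_s]$. $\mathcal{B}$ is defined similarly with $\hom(g,g)=B_g$, the braid group on $g$ strings with standard generators $\sigma_1,\dots,\sigma_{g-1}$; the monoidal structure is juxtaposition of braids, and the braiding is $$\sigma_{r,s}=(\sigma_r\sigma_{r-1}\cdots\sigma_1)(\sigma_{r+1}\sigma_r\cdots\sigma_2)\cdots(\sigma_{r+s-1}\sigma_{r+s-2}\cdots\sigma_s)\in B_{r+s}.$$ The element $\beta_i\in\Gamma_{g,1}$ $(1\le i\le g-1)$ is the automorphism, with $R_i=[y_i,x_i]$, $$x_i\mapsto R_ix_{i+1}R_i^{-1},\quad y_i\mapsto R_iy_{i+1}R_i^{-1},\quad x_{i+1}\mapsto x_i,\quad y_{i+1}\mapsto y_i,$$ fixing the other generators; these satisfy the braid relations. A braided monoidal functor is a monoidal functor that preserves the braidings (here $\Phi(\sigma_{r,s})=\beta_{r,s}$). *)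

(* Defs.v *)
From HB Require Import structures.
From mathcomp Require Import all_boot.
From mathcomp Require Import boolp zify.

Set Implicit Arguments.
Unset Strict Implicit.
Unset Printing Implicit Defensive.

Local Open Scope quotient_scope.
Local Open Scope group_scope.

(* Words over X: the letter (a, false) stands for a, (a, true) for its inverse. *)
Definition word (X : Type) := seq (X * bool).

Section PresentedGroup.
Variables (X : choiceType) (R : word X -> word X -> Prop).
Implicit Types u v w : word X.

(* The group with generators X and relations r1 = r2 for R r1 r2. *)
Inductive pres_equiv : word X -> word X -> Prop :=
| PresRefl w : pres_equiv w w
| PresSym u v : pres_equiv u v -> pres_equiv v u
| PresTrans u v w : pres_equiv u v -> pres_equiv v w -> pres_equiv u w
| PresCancel u a b v : pres_equiv (u ++ [:: (a, b); (a, ~~ b)] ++ v) (u ++ v)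
| PresRel u r1 r2 v : R r1 r2 -> pres_equiv (u ++ r1 ++ v) (u ++ r2 ++ v).

Definition pres_equivb u v := `[< pres_equiv u v >].

Lemma pres_equivb_refl : reflexive pres_equivb.
Proof. by move=> w; apply/asboolP/PresRefl. Qed.
Lemma pres_equivb_sym : symmetric pres_equivb.
Proof. by move=> u v; apply/asboolP/asboolP; apply: PresSym. Qed.
Lemma pres_equivb_trans : transitive pres_equivb.
Proof.
by move=> v u w /asboolP uv /asboolP vw; apply/asboolP/(PresTrans uv vw).
Qed.

Canonical pres_equiv_rel :=
  EquivRel pres_equivb pres_equivb_refl pres_equivb_sym pres_equivb_trans.

Definition presented := {eq_quot pres_equivb}.
HB.instance Definition _ := EqQuotient.on presented.
HB.instance Definition _ := Choice.on presented.

Lemma pres_eqP u v : pres_equiv u v <-> \pi_presented u = \pi_presented v.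
Proof.
split=> [uv|uv]; first by apply/eqmodP; apply/asboolP.
by apply/asboolP; move/eqmodP: uv.
Qed.

Definition word_inv w : word X := rev [seq (l.1, ~~ l.2) | l <- w].

Lemma pres_equiv_cat u u' v v' :
  pres_equiv u u' -> pres_equiv v v' -> pres_equiv (u ++ v) (u' ++ v').
Proof.
have catl w : forall u v, pres_equiv u v -> pres_equiv (w ++ u) (w ++ v).
  move=> u0 v0; elim=> [z|z t _|z t s _ h1 _|z a b t|z r1 r2 t h].
  - exact: PresRefl.
  - exact: PresSym.
  - exact: PresTrans h1.
  - by rewrite !(catA w); apply: PresCancel.
  - by rewrite !(catA w); apply: PresRel.
have catr w : forall u v, pres_equiv u v -> pres_equiv (u ++ w) (v ++ w).
  move=> u0 v0; elim=> [z|z t _|z t s _ h1 _|z a b t|z r1 r2 t h].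
  - exact: PresRefl.
  - exact: PresSym.
  - exact: PresTrans h1.
  - by rewrite -!catA; apply: PresCancel.
  - by rewrite -!catA; apply: PresRel.
by move=> uu' vv'; apply: PresTrans (catr v _ _ uu') (catl u' _ _ vv').
Qed.

Lemma pres_cancel_inv w : pres_equiv (word_inv w ++ w) [::].
Proof.
elim: w => [|[a b] w ih]; first exact: PresRefl.
rewrite /word_inv /= rev_cons -cats1 -catA.
apply: PresTrans ih; have := PresCancel (word_inv w) a (~~ b) w.
by rewrite negbK.
Qed.

Lemma word_invK : involutive word_inv.
Proof.
move=> w; rewrite /word_inv map_rev revK -map_comp.
by rewrite -[RHS]map_id; apply: eq_map => -[a b] /=; rewrite negbK.
Qed.

Lemma pres_cancel_invr w : pres_equiv (w ++ word_inv w) [::].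
Proof. by rewrite -{1}(word_invK w); apply: pres_cancel_inv. Qed.

Definition pres_one : presented := \pi_presented [::].
Definition pres_mul (u v : presented) : presented := \pi_presented (repr u ++ repr v).
Definition pres_inv (u : presented) : presented := \pi_presented (word_inv (repr u)).

Lemma repr_equiv w : pres_equiv (repr (\pi_presented w)) w.
Proof. by apply/pres_eqP; rewrite reprK. Qed.

Lemma pres_mulE u v :
  pres_mul (\pi_presented u) (\pi_presented v) = \pi_presented (u ++ v).
Proof. by apply/pres_eqP/pres_equiv_cat; apply: repr_equiv. Qed.

Lemma pres_mulA : associative pres_mul.
Proof.
move=> u v w; elim/quotW: u => u; elim/quotW: v => v; elim/quotW: w => w.
by rewrite (pres_mulE v w) (pres_mulE u v) !pres_mulE catA.
Qed.
Lemma pres_mul1 : left_id pres_one pres_mul.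
Proof. by move=> u; elim/quotW: u => u; rewrite pres_mulE. Qed.
Lemma pres_mulr1 : right_id pres_one pres_mul.
Proof. by move=> u; elim/quotW: u => u; rewrite pres_mulE cats0. Qed.
Lemma pres_mulV : left_inverse pres_one pres_inv pres_mul.
Proof.
move=> u; elim/quotW: u => u; rewrite -[X in pres_mul _ X]reprK pres_mulE.
exact/pres_eqP/pres_cancel_inv.
Qed.
Lemma pres_mulrV : right_inverse pres_one pres_inv pres_mul.
Proof.
move=> u; elim/quotW: u => u; rewrite -[X in pres_mul X _]reprK pres_mulE.
exact/pres_eqP/pres_cancel_invr.
Qed.

HB.instance Definition _ := isGroup.Build presented
  pres_mulA pres_mul1 pres_mulr1 pres_mulV pres_mulrV.

Definition pres_gen (a : X) : presented := \pi_presented [:: (a, false)].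

Section Lift.
Variables (G : groupType) (f : X -> G).

Definition word_eval w : G :=
  \prod_(l <- w) (if l.2 then (f l.1)^-1 else f l.1).

Hypothesis fR : forall r1 r2, R r1 r2 -> word_eval r1 = word_eval r2.

Definition pres_lift of (forall r1 r2, R r1 r2 -> word_eval r1 = word_eval r2) :=
  fun u : presented => word_eval (repr u).

Lemma word_eval_equiv u v : pres_equiv u v -> word_eval u = word_eval v.
Proof.
elim=> [//|//|z t s _ -> _ //|z a b t|z r1 r2 t h]; rewrite /word_eval !big_cat.
  congr (_ * _); rewrite big_cons big_seq1 /=.
  by case: b; rewrite /= ?mulgV ?mulVg mul1g.
by congr (_ * (_ * _)); apply: fR.
Qed.

Lemma pres_lift_pi w : pres_lift fR (\pi_presented w) = word_eval w.
Proof. exact/word_eval_equiv/repr_equiv. Qed.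

Lemma pres_lift_gen a : pres_lift fR (pres_gen a) = f a.
Proof. by rewrite pres_lift_pi /word_eval big_seq1. Qed.

Lemma pres_lift_morph : {morph pres_lift fR : u v / u * v}.
Proof.
move=> u v; elim/quotW: u => u; elim/quotW: v => v.
by rewrite [_ * _]pres_mulE !pres_lift_pi /word_eval big_cat.
Qed.

HB.instance Definition _ :=
  isMultiplicative.Build presented G (pres_lift fR) pres_lift_morph.
End Lift.

Lemma pres_ind (P : presented -> Prop) :
  P 1 -> (forall a (x : presented), P x -> P (pres_gen a * x)) ->
  (forall a (x : presented), P x -> P ((pres_gen a)^-1 * x)) -> forall x, P x.
Proof.
move=> P1 Pg Pv x; elim/quotW: x; elim=> [//|[a b] w ih].
rewrite -[_ :: _]cat1s -pres_mulE; case: b; last exact: Pg.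
suff -> : \pi_presented [:: (a, true)] = (pres_gen a)^-1 by apply: Pv.
apply/esym/mulg1_eq; rewrite [_ * _]pres_mulE; apply/pres_eqP.
exact: (PresCancel [::] a false [::]).
Qed.

End PresentedGroup.

Lemma mult1 (G H : groupType) (f : {multiplicative G -> H}) : f 1 = 1.
Proof. by apply: (mulgI (f 1)); rewrite -gmulfM !mulg1. Qed.

Lemma multV (G H : groupType) (f : {multiplicative G -> H}) x :
  f x^-1 = (f x)^-1.
Proof. by apply/esym/mulg1_eq; rewrite -gmulfM mulgV mult1. Qed.

Lemma mult_prod (G H : groupType) (f : {multiplicative G -> H}) I (r : seq I) P E :
  f (\prod_(i <- r | P i) E i) = \prod_(i <- r | P i) f (E i).
Proof. exact: (big_morph f (@gmulfM _ _ f) (mult1 f)). Qed.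

Lemma mult_ext (G H : groupType) (f h : {multiplicative G -> H}) :
  f =1 h -> f = h.
Proof.
case: f h => [f [[fM]]] [h [[hM]]] /= /funext fh; case: _ / fh in hM *.
by rewrite (Prop_irrelevance hM fM).
Qed.

Lemma pres_hom_ext (X : choiceType) (R : word X -> word X -> Prop)
    (G : groupType) (f h : {multiplicative presented R -> G}) :
  (forall a, f (pres_gen R a) = h (pres_gen R a)) -> f =1 h.
Proof.
move=> fh; elim/pres_ind => [|a u ih|a u ih]; first by rewrite !mult1.
  by rewrite !gmulfM fh ih.
by rewrite !gmulfM !multV fh ih.
Qed.

(* Morphisms are composed in diagrammatic order: f \; g is f followed by g. *)
Structure category := Category {
  obj :> Type;
  hom : obj -> obj -> Type;
  idm : forall a, hom a a;
  compm : forall a b c, hom a b -> hom b c -> hom a c;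
  compm1 : forall a b (f : hom a b), compm f (idm b) = f;
  comp1m : forall a b (f : hom a b), compm (idm a) f = f;
  compmA : forall a b c d (f : hom a b) (g : hom b c) (h : hom c d),
    compm f (compm g h) = compm (compm f g) h
}.
Arguments idm {c} a : rename.
Arguments compm {c a b c0} f g : rename.

Declare Scope cat_scope.
Delimit Scope cat_scope with cat.
Local Open Scope cat_scope.
Notation "f \; g" := (compm f g) : cat_scope.

Definition inverse_of (C : category) (a b : C) (f : hom a b) (g : hom b a) :=
  f \; g = idm a /\ g \; f = idm b.
Definition is_iso (C : category) (a b : C) (f : hom a b) :=
  exists g, inverse_of f g.

Reserved Notation "a \tens b" (at level 40, left associativity).
Reserved Notation "f \tensm g" (at level 40, left associativity).

Structure monoidal_category := MonoidalCategory {
  mon_cat :> category;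
  tens : mon_cat -> mon_cat -> mon_cat;
  tensm : forall a b c d : mon_cat,
    hom a b -> hom c d -> hom (tens a c) (tens b d);
  munit : mon_cat;
  massoc : forall a b c, hom (tens (tens a b) c) (tens a (tens b c));
  massocV : forall a b c, hom (tens a (tens b c)) (tens (tens a b) c);
  mlunit : forall a, hom (tens munit a) a;
  mrunit : forall a, hom (tens a munit) a;
  tensm1 : forall a b, tensm (idm a) (idm b) = idm (tens a b);
  tensm_comp : forall a b c a' b' c' (f : hom a b) (g : hom b c)
      (f' : hom a' b') (g' : hom b' c'),
    tensm (f \; g) (f' \; g') = tensm f f' \; tensm g g';
  massocK : forall a b c, inverse_of (massoc a b c) (massocV a b c);
  mlunit_iso : forall a, is_iso (mlunit a);
  mrunit_iso : forall a, is_iso (mrunit a);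
  massoc_nat : forall a b c a' b' c' (f : hom a a') (g : hom b b') (h : hom c c'),
    tensm (tensm f g) h \; massoc a' b' c' = massoc a b c \; tensm f (tensm g h);
  mlunit_nat : forall a a' (f : hom a a'),
    tensm (idm munit) f \; mlunit a' = mlunit a \; f;
  mrunit_nat : forall a a' (f : hom a a'),
    tensm f (idm munit) \; mrunit a' = mrunit a \; f;
  pentagon : forall a b c d,
    massoc (tens a b) c d \; massoc a b (tens c d) =
    tensm (massoc a b c) (idm d) \; massoc a (tens b c) d
      \; tensm (idm a) (massoc b c d);
  triangle : forall a b,
    massoc a munit b \; tensm (idm a) (mlunit b) = tensm (mrunit a) (idm b)
}.
Arguments tens {m} a b : rename.
Arguments tensm {m a b c d} f g : rename.
Arguments munit {m} : rename.
Notation "a \tens b" := (tens a b) : cat_scope.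
Notation "f \tensm g" := (tensm f g) : cat_scope.

Structure braided_category := BraidedCategory {
  braided_mon :> monoidal_category;
  braiding : forall a b : braided_mon, hom (a \tens b) (b \tens a);
  braiding_iso : forall a b, is_iso (braiding a b);
  braiding_nat : forall a b a' b' (f : hom a a') (g : hom b b'),
    (f \tensm g) \; braiding a' b' = braiding a b \; (g \tensm f);
  hexagon : forall a b c,
    massoc a b c \; braiding a (b \tens c) \; massoc b c a =
    (braiding a b \tensm idm c) \; massoc b a c \; (idm b \tensm braiding a c);
  hexagonV : forall a b c,
    massocV a b c \; braiding (a \tens b) c \; massocV c a b =
    (idm a \tensm braiding b c) \; massocV a c b \; (braiding a c \tensm idm b)
}.

(* Functors whose action on objects is the given F0. *)
Structure functor_on (C D : category) (F0 : C -> D) := FunctorOn {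
  Fmor :> forall a b, hom a b -> hom (F0 a) (F0 b);
  Fmor1 : forall a, Fmor (idm a) = idm (F0 a);
  Fmor_comp : forall a b c (f : hom a b) (g : hom b c),
    Fmor (f \; g) = Fmor f \; Fmor g
}.
Arguments Fmor {C D F0} f {a b} : rename.

Structure monoidal_functor_on (C D : monoidal_category) (F0 : C -> D) :=
  MonoidalFunctorOn {
  monF :> functor_on F0;
  Fmu : forall a b, hom (F0 a \tens F0 b) (F0 (a \tens b));
  Feps : hom munit (F0 munit);
  Fmu_iso : forall a b, is_iso (Fmu a b);
  Feps_iso : is_iso Feps;
  Fmu_nat : forall a b a' b' (f : hom a a') (g : hom b b'),
    (monF a a' f \tensm monF b b' g) \; Fmu a' b' = Fmu a b \; monF _ _ (f \tensm g);
  Fmu_assoc : forall a b c,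
    (Fmu a b \tensm idm (F0 c)) \; Fmu (a \tens b) c \; monF _ _ (massoc a b c) =
    massoc (F0 a) (F0 b) (F0 c) \; (idm (F0 a) \tensm Fmu b c) \; Fmu a (b \tens c);
  Fmu_lunit : forall a,
    (Feps \tensm idm (F0 a)) \; Fmu munit a \; monF _ _ (mlunit a) = mlunit (F0 a);
  Fmu_runit : forall a,
    (idm (F0 a) \tensm Feps) \; Fmu a munit \; monF _ _ (mrunit a) = mrunit (F0 a)
}.

Structure braided_functor_on (C D : braided_category) (F0 : C -> D) :=
  BraidedFunctorOn {
  braidedF :> monoidal_functor_on F0;
  Fbraiding : forall a b,
    Fmu braidedF a b \; Fmor braidedF (braiding a b) =
    braiding (F0 a) (F0 b) \; Fmu braidedF b a
}.
Arguments Fmu {C D F0} f a b : rename.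
Arguments Feps {C D F0} f : rename.

(* The category with objects the natural numbers, hom(n, n) = G n, and no
   morphisms between distinct objects. *)
Section Coproduct.
Variable G : nat -> groupType.

Inductive coprod_hom : nat -> nat -> Type :=
  EndHom n of G n : coprod_hom n n.

Definition coprod_comp a b c (f : coprod_hom a b) :
    coprod_hom b c -> coprod_hom a c :=
  match f in coprod_hom a b return coprod_hom b c -> coprod_hom a c with
  | EndHom _ x => fun g =>
    match g in coprod_hom b c return G b -> coprod_hom b c with
    | EndHom _ y => fun x => EndHom (x * y)
    end x
  end.

Fact coprod_comp1 a b (f : coprod_hom a b) :
  coprod_comp f (EndHom (1 : G b)) = f.
Proof. by case: f => n x /=; rewrite mulg1. Qed.
Fact coprod_1comp a b (f : coprod_hom a b) :
  coprod_comp (EndHom (1 : G a)) f = f.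
Proof. by case: f => n x /=; rewrite mul1g. Qed.
Fact coprod_compA a b c d (f : coprod_hom a b) (g : coprod_hom b c)
    (h : coprod_hom c d) :
  coprod_comp f (coprod_comp g h) = coprod_comp (coprod_comp f g) h.
Proof.
case: f g h => n x g h; case: g x h => m y x h; case: h x y => p z x y.
by rewrite /= mulgA.
Qed.

Definition coprod : category :=
  @Category nat coprod_hom (fun n => EndHom (1 : G n)) coprod_comp
    coprod_comp1 coprod_1comp coprod_compA.

(* The identity of a, seen as a morphism to b = a; the associator and the unitors
   below are of this form. *)
Definition eqhom a b (e : a = b) : @hom coprod a b :=
  match e with erefl => idm (a : coprod) end.

Lemma eqhom_irr a b (e e' : a = b) : eqhom e = eqhom e'.
Proof. by congr eqhom; apply: eq_irrelevance. Qed.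

Lemma eqhom_comp a b c (e : a = b) (e' : b = c) :
  eqhom e \; eqhom e' = eqhom (etrans e e').
Proof. by case: c / e'; case: b / e; rewrite comp1m. Qed.

Lemma eqhom_iso a b (e : a = b) : inverse_of (eqhom e) (eqhom (esym e)).
Proof. by split; rewrite eqhom_comp; case: b / e. Qed.

Variable t : forall m n, G m -> G n -> G (m + n)%N.

Structure tensor_axioms := TensorAxioms {
  t1 : forall m n, t (1 : G m) (1 : G n) = 1;
  tM : forall m n (x x' : G m) (y y' : G n), t (x * x') (y * y') = t x y * t x' y';
  tA : forall l m n (x : G l) (y : G m) (z : G n),
    (EndHom (t (t x y) z) : @hom coprod _ _) \; eqhom (esym (addnA l m n)) =
    eqhom (esym (addnA l m n)) \; EndHom (t x (t y z));
  tl : forall n (x : G n),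
    (EndHom (t (1 : G 0) x) : @hom coprod _ _) \; eqhom (add0n n) =
    eqhom (add0n n) \; EndHom x;
  tr : forall n (x : G n),
    (EndHom (t x (1 : G 0)) : @hom coprod _ _) \; eqhom (addn0 n) =
    eqhom (addn0 n) \; EndHom x
}.
Hypothesis tP : tensor_axioms.

Definition coprod_tensm (a b c d : coprod) (f : hom a b) (g : hom c d) :
    @hom coprod (a + c)%N (b + d)%N :=
  match f in coprod_hom a b, g in coprod_hom c d
    return coprod_hom (a + c) (b + d) with
  | EndHom _ x, EndHom _ y => EndHom (t x y)
  end.

Fact coprod_tensm1 (a b : coprod) :
  coprod_tensm (idm a) (idm b) = idm ((a + b)%N : coprod).
Proof. by rewrite /= (t1 tP). Qed.

Fact coprod_tensm_comp (a b c a' b' c' : coprod) (f : hom a b) (g : hom b c)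
    (f' : hom a' b') (g' : hom b' c') :
  coprod_tensm (f \; g) (f' \; g') = coprod_tensm f f' \; coprod_tensm g g'.
Proof.
case: f g => n x g; case: g x => m y x; case: f' g' => n' x' g'.
by case: g' x' => m' y' x'; rewrite /= tM.
Qed.

Lemma eqhom_tensm a b c d (e : a = b) (e' : c = d) :
  coprod_tensm (eqhom e) (eqhom e') = eqhom (f_equal2 addn e e').
Proof. by case: b / e; case: d / e'; rewrite /= (t1 tP); apply: (eqhom_irr erefl). Qed.

Lemma eqhom_tensm1 (a b c : coprod) (e : b = c) :
  coprod_tensm (idm a) (eqhom e) = eqhom (f_equal (addn a) e).
Proof. by rewrite (eqhom_tensm (erefl a)); apply: eqhom_irr. Qed.

Lemma eqhom_1tensm (a b c : coprod) (e : b = c) :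
  coprod_tensm (eqhom e) (idm a) = eqhom (f_equal (addn^~ a) e).
Proof. by rewrite (eqhom_tensm e (erefl a)); apply: eqhom_irr. Qed.

Fact coprod_assocK (a b c : coprod) :
  inverse_of (eqhom (esym (addnA a b c))) (eqhom (addnA a b c)).
Proof.
have := eqhom_iso (esym (addnA a b c)).
by rewrite (eqhom_irr (esym (esym _)) (addnA a b c)).
Qed.
Fact coprod_eqhom_iso a b (e : a = b) : is_iso (eqhom e).
Proof. by exists (eqhom (esym e)); apply: eqhom_iso. Qed.
Fact coprod_assoc_nat (a b c a' b' c' : coprod) (f : hom a a') (g : hom b b')
    (h : hom c c') :
  coprod_tensm (coprod_tensm f g) h \; eqhom (esym (addnA a' b' c')) =
  eqhom (esym (addnA a b c)) \; coprod_tensm f (coprod_tensm g h).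
Proof. by case: f => n x; case: g => m y; case: h => p z; apply: (tA tP). Qed.
Fact coprod_lunit_nat (a a' : coprod) (f : hom a a') :
  coprod_tensm (idm (0%N : coprod)) f \; eqhom (add0n a') = eqhom (add0n a) \; f.
Proof. by case: f => n x; apply: (tl tP). Qed.
Fact coprod_runit_nat (a a' : coprod) (f : hom a a') :
  coprod_tensm f (idm (0%N : coprod)) \; eqhom (addn0 a') = eqhom (addn0 a) \; f.
Proof. by case: f => n x; apply: (tr tP). Qed.
Fact coprod_pentagon (a b c d : coprod) :
  eqhom (esym (addnA (a + b) c d)) \; eqhom (esym (addnA a b (c + d))) =
  coprod_tensm (eqhom (esym (addnA a b c))) (idm d)
    \; eqhom (esym (addnA a (b + c) d))
    \; coprod_tensm (idm a) (eqhom (esym (addnA b c d))).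
Proof.
by rewrite eqhom_tensm1 eqhom_1tensm !eqhom_comp; apply: eqhom_irr.
Qed.
Fact coprod_triangle (a b : coprod) :
  eqhom (esym (addnA a 0 b)) \; coprod_tensm (idm a) (eqhom (add0n b)) =
  coprod_tensm (eqhom (addn0 a)) (idm b).
Proof.
by rewrite eqhom_tensm1 eqhom_1tensm !eqhom_comp; apply: eqhom_irr.
Qed.

Definition coprod_monoidal : monoidal_category :=
  @MonoidalCategory coprod addn coprod_tensm 0%N
    (fun a b c => eqhom (esym (addnA a b c))) (fun a b c => eqhom (addnA a b c))
    (fun a => eqhom (add0n a)) (fun a => eqhom (addn0 a))
    coprod_tensm1 coprod_tensm_comp coprod_assocK
    (fun a => coprod_eqhom_iso (add0n a)) (fun a => coprod_eqhom_iso (addn0 a))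
    coprod_assoc_nat coprod_lunit_nat coprod_runit_nat
    coprod_pentagon coprod_triangle.

End Coproduct.

Section CoproductTheory.
Variable G : nat -> groupType.

Definition hom_eq a b (f : @hom (coprod G) a b) : a = b :=
  match f with EndHom n _ => erefl n end.
Definition hom_val a b (f : @hom (coprod G) a b) : G a :=
  match f with EndHom _ x => x end.
Definition castG m n (e : m = n) : G m -> G n :=
  match e with erefl => id end.

Lemma homE a b (f : @hom (coprod G) a b) :
  f = (EndHom (hom_val f) : @hom (coprod G) a a) \; eqhom (hom_eq f).
Proof. by case: f => n x /=; rewrite mulg1. Qed.

Lemma hom_val_inj a b (f g : @hom (coprod G) a b) : hom_val f = hom_val g -> f = g.
Proof. by rewrite {2}(homE f) {2}(homE g) => ->; congr compm; apply: eqhom_irr. Qed.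

Lemma hom_val_comp a b c (f : @hom (coprod G) a b) (g : @hom (coprod G) b c) :
  hom_val (f \; g) = hom_val f * castG (esym (hom_eq f)) (hom_val g).
Proof. by case: f g => n x g; case: g x. Qed.

Lemma hom_val_eqhom a b (e : a = b) : hom_val (@eqhom G a b e) = 1.
Proof. by case: b / e. Qed.

Lemma coprod_iso a b (f : @hom (coprod G) a b) : is_iso f.
Proof.
case: f => n x; exists (EndHom x^-1 : @hom (coprod G) n n).
by split; rewrite /= ?mulgV ?mulVg.
Qed.
End CoproductTheory.

(* The fundamental group of S_{g,1}: the letter (i, false) is x_i and (i, true)
   is y_i. *)
Definition pi1 (g : nat) : groupType :=
  presented (fun _ _ : word ('I_g * bool)%type => False).

Definition px g (i : 'I_g) : pi1 g := pres_gen _ (i, false).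
Definition py g (i : 'I_g) : pi1 g := pres_gen _ (i, true).

Definition pi1_hom g (G : groupType) (u v : 'I_g -> G) :
    {multiplicative pi1 g -> G} :=
  @pres_lift _ (fun _ _ => False) G (fun l => if l.2 then v l.1 else u l.1)
    (fun _ _ => False_ind _).

Lemma pi1_hom_x g (G : groupType) (u v : 'I_g -> G) i : pi1_hom u v (px i) = u i.
Proof. exact: pres_lift_gen. Qed.
Lemma pi1_hom_y g (G : groupType) (u v : 'I_g -> G) i : pi1_hom u v (py i) = v i.
Proof. exact: pres_lift_gen. Qed.
Definition pi1_homE := (pi1_hom_x, pi1_hom_y).

Lemma pi1_ext g (G : groupType) (f h : {multiplicative pi1 g -> G}) :
  (forall i, f (px i) = h (px i)) -> (forall i, f (py i) = h (py i)) -> f =1 h.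
Proof. by move=> fx fy; apply: pres_hom_ext => -[i []]; [apply: fy | apply: fx]. Qed.

Lemma pi1_ext2 g (G1 G2 G : groupType)
    (f : {multiplicative G1 -> G}) (f' : {multiplicative pi1 g -> G1})
    (h : {multiplicative G2 -> G}) (h' : {multiplicative pi1 g -> G2}) :
  (forall i, f (f' (px i)) = h (h' (px i))) ->
  (forall i, f (f' (py i)) = h (h' (py i))) -> forall u, f (f' u) = h (h' u).
Proof. exact: (@pi1_ext g G (f \o f') (h \o h')). Qed.

Lemma pi1_ext1 g (G1 G : groupType)
    (f : {multiplicative G1 -> G}) (f' : {multiplicative pi1 g -> G1})
    (h : {multiplicative pi1 g -> G}) :
  (forall i, f (f' (px i)) = h (px i)) ->
  (forall i, f (f' (py i)) = h (py i)) -> forall u, f (f' u) = h u.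
Proof. exact: (@pi1_ext g G (f \o f') h). Qed.

(* Not the library's commutator [~ a, b] = a^-1 b^-1 a b. *)
Definition comm (G : groupType) (a b : G) : G := a * b * a^-1 * b^-1.

Lemma mult_comm (G H : groupType) (f : {multiplicative G -> H}) a b :
  f (comm a b) = comm (f a) (f b).
Proof. by rewrite /comm !gmulfM !multV. Qed.

Lemma comm_conj (G : groupType) (q a b : G) :
  comm (q * a * q^-1) (q * b * q^-1) = q * comm a b * q^-1.
Proof. by rewrite /comm !invgM !invgK !mulgA !mulgVK. Qed.

Definition pR g (i : 'I_g) : pi1 g := comm (py i) (px i).
Definition boundary g : pi1 g := \prod_(i < g) pR i.

(* Gamma_{g,1}, as the group of automorphisms of the free group pi1 g that fix
   the boundary word. *)
Record mcg (g : nat) := Mcg {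
  mcg_hom :> {multiplicative pi1 g -> pi1 g};
  mcg_bij : bijective mcg_hom;
  mcg_boundary : mcg_hom (boundary g) = boundary g
}.

Section MappingClassGroup.
Variable g : nat.
Implicit Types f h k : mcg g.

Lemma mcg_ext f h : f =1 h -> f = h.
Proof.
case: f h => [f fb fd] [h hb hd] /= /mult_ext fh; case: _ / fh in hb hd *.
by rewrite (Prop_irrelevance fb hb) (Prop_irrelevance fd hd).
Qed.

HB.instance Definition _ := gen_eqMixin (mcg g).
HB.instance Definition _ := gen_choiceMixin (mcg g).

Definition mcg_invfun f : pi1 g -> pi1 g :=
  sval (cid (let: Bijective r fr rf := mcg_bij f in
             ex_intro (fun r => cancel f r /\ cancel r f) r (conj fr rf))).
Lemma mcg_invfunK f : cancel f (mcg_invfun f).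
Proof. by rewrite /mcg_invfun; case: cid => r []. Qed.
Lemma mcg_invfunKV f : cancel (mcg_invfun f) f.
Proof. by rewrite /mcg_invfun; case: cid => r []. Qed.
Fact mcg_inv_morph f : {morph mcg_invfun f : u v / u * v}.
Proof. exact: can2_gmulfM (mcg_invfunK f) (mcg_invfunKV f). Qed.
HB.instance Definition _ f :=
  isMultiplicative.Build (pi1 g) (pi1 g) (mcg_invfun f) (mcg_inv_morph f).

Fact mcg_mul_boundary f h : (h \o f) (boundary g) = boundary g.
Proof. by rewrite /= !mcg_boundary. Qed.
Fact mcg_inv_boundary f : mcg_invfun f (boundary g) = boundary g.
Proof. by rewrite -{1}(mcg_boundary f) mcg_invfunK. Qed.

Definition mcg_one : mcg g :=
  @Mcg g (@idfun (pi1 g)) (Bijective (frefl _) (frefl _)) erefl.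
(* Automorphisms act on the right: in a product, the left factor is applied
   first. *)
Definition mcg_mul f h : mcg g :=
  @Mcg g (h \o f) (bij_comp (mcg_bij h) (mcg_bij f)) (mcg_mul_boundary f h).
Definition mcg_inv f : mcg g :=
  @Mcg g (mcg_invfun f) (Bijective (mcg_invfunKV f) (mcg_invfunK f))
    (mcg_inv_boundary f).

Fact mcg_mulA : associative mcg_mul.
Proof. by move=> f h k; apply: mcg_ext. Qed.
Fact mcg_mul1 : left_id mcg_one mcg_mul.
Proof. by move=> f; apply: mcg_ext. Qed.
Fact mcg_mulr1 : right_id mcg_one mcg_mul.
Proof. by move=> f; apply: mcg_ext. Qed.
Fact mcg_mulV : left_inverse mcg_one mcg_inv mcg_mul.
Proof. by move=> f; apply: mcg_ext => u /=; rewrite mcg_invfunKV. Qed.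
Fact mcg_mulrV : right_inverse mcg_one mcg_inv mcg_mul.
Proof. by move=> f; apply: mcg_ext => u /=; rewrite mcg_invfunK. Qed.

HB.instance Definition _ := isGroup.Build (mcg g)
  mcg_mulA mcg_mul1 mcg_mulr1 mcg_mulV mcg_mulrV.
End MappingClassGroup.

Definition pi1_map m n (s : 'I_m -> 'I_n) : {multiplicative pi1 m -> pi1 n} :=
  pi1_hom (fun i => px (s i)) (fun i => py (s i)).

Lemma pi1_map_x m n (s : 'I_m -> 'I_n) i : pi1_map s (px i) = px (s i).
Proof. exact: pi1_hom_x. Qed.
Lemma pi1_map_y m n (s : 'I_m -> 'I_n) i : pi1_map s (py i) = py (s i).
Proof. exact: pi1_hom_y. Qed.
Definition pi1_mapE := (pi1_map_x, pi1_map_y).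

Lemma pi1_map_R m n (s : 'I_m -> 'I_n) i : pi1_map s (pR i) = pR (s i).
Proof. by rewrite mult_comm !pi1_mapE. Qed.

Lemma pi1_map_comp m n p (s : 'I_m -> 'I_n) (t : 'I_n -> 'I_p) u :
  pi1_map t (pi1_map s u) = pi1_map (t \o s) u.
Proof. by apply: pi1_ext1 u => i; rewrite !pi1_mapE. Qed.

Lemma pi1_map_id m (s : 'I_m -> 'I_m) : s =1 id -> pi1_map s =1 id.
Proof.
move=> sE u; apply: (@pi1_ext _ _ (pi1_map s) idfun _ _ u) => i;
by rewrite pi1_mapE sE.
Qed.

Lemma pi1_map_boundary m n (e : m = n) :
  pi1_map (cast_ord e) (boundary m) = boundary n.
Proof.
by case: n / e; apply: pi1_map_id => i; apply: val_inj.
Qed.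

(* The F-product: f acts on the first g pairs of generators, h on the last k. *)
Section FProduct.
Variables g k : nat.

Definition fprod_gen (f : pi1 g -> pi1 g) (h : pi1 k -> pi1 k)
    (zg : 'I_g -> pi1 g) (zk : 'I_k -> pi1 k) (i : 'I_(g + k)) : pi1 (g + k) :=
  match split i with
  | inl j => pi1_map (lshift k) (f (zg j))
  | inr j => pi1_map (@rshift g k) (h (zk j))
  end.

Definition fprod_hom (f : pi1 g -> pi1 g) (h : pi1 k -> pi1 k) :
    {multiplicative pi1 (g + k) -> pi1 (g + k)} :=
  pi1_hom (fprod_gen f h (@px g) (@px k)) (fprod_gen f h (@py g) (@py k)).

Lemma split_l (i : 'I_g) : split (lshift k i) = inl i.
Proof. exact: (unsplitK (inl i)). Qed.
Lemma split_r (i : 'I_k) : split (rshift g i) = inr i.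
Proof. exact: (unsplitK (inr i)). Qed.

Lemma fprod_hom_l (f : {multiplicative pi1 g -> pi1 g}) (h : pi1 k -> pi1 k) u :
  fprod_hom f h (pi1_map (lshift k) u) = pi1_map (lshift k) (f u).
Proof.
by apply: pi1_ext2 u => i; rewrite pi1_mapE pi1_homE /fprod_gen split_l.
Qed.

Lemma fprod_hom_r (f : pi1 g -> pi1 g) (h : {multiplicative pi1 k -> pi1 k}) u :
  fprod_hom f h (pi1_map (@rshift g k) u) = pi1_map (@rshift g k) (h u).
Proof.
by apply: pi1_ext2 u => i; rewrite pi1_mapE pi1_homE /fprod_gen split_r.
Qed.

Lemma pi1_ext_split (G : groupType) (f h : {multiplicative pi1 (g + k) -> G}) :
  (forall u, f (pi1_map (lshift k) u) = h (pi1_map (lshift k) u)) ->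
  (forall u, f (pi1_map (@rshift g k) u) = h (pi1_map (@rshift g k) u)) -> f =1 h.
Proof.
move=> fl fr; apply: pi1_ext => i; rewrite -(splitK i); case: (split i) => j /=;
by rewrite -?(pi1_map_x (lshift k)) -?(pi1_map_y (lshift k))
           -?(pi1_map_x (@rshift g k)) -?(pi1_map_y (@rshift g k)) ?fl ?fr.
Qed.

Lemma pi1_ext_split1 (G1 G : groupType)
    (f : {multiplicative G1 -> G}) (f' : {multiplicative pi1 (g + k) -> G1})
    (h : {multiplicative pi1 (g + k) -> G}) :
  (forall u, f (f' (pi1_map (lshift k) u)) = h (pi1_map (lshift k) u)) ->
  (forall u, f (f' (pi1_map (@rshift g k) u)) = h (pi1_map (@rshift g k) u)) ->
  forall u, f (f' u) = h u.
Proof. exact: (@pi1_ext_split G (f \o f') h). Qed.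

Lemma pi1_ext_split2 (G1 G2 G : groupType)
    (f : {multiplicative G1 -> G}) (f' : {multiplicative pi1 (g + k) -> G1})
    (h : {multiplicative G2 -> G}) (h' : {multiplicative pi1 (g + k) -> G2}) :
  (forall u, f (f' (pi1_map (lshift k) u)) = h (h' (pi1_map (lshift k) u))) ->
  (forall u, f (f' (pi1_map (@rshift g k) u)) =
             h (h' (pi1_map (@rshift g k) u))) ->
  forall u, f (f' u) = h (h' u).
Proof. exact: (@pi1_ext_split G (f \o f') (h \o h')). Qed.

Lemma fprod_hom_comp (f f' : {multiplicative pi1 g -> pi1 g})
    (h h' : {multiplicative pi1 k -> pi1 k}) u :
  fprod_hom f h (fprod_hom f' h' u) = fprod_hom (f \o f') (h \o h') u.
Proof.
by apply: pi1_ext_split1 u => v; rewrite ?fprod_hom_l ?fprod_hom_r.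
Qed.

Lemma fprod_hom_id : fprod_hom idfun idfun =1 idfun.
Proof.
by apply: pi1_ext_split => v /=; rewrite ?fprod_hom_l ?fprod_hom_r.
Qed.

Lemma boundaryD : boundary (g + k) =
  pi1_map (lshift k) (boundary g) * pi1_map (@rshift g k) (boundary k).
Proof.
rewrite /boundary big_split_ord !mult_prod.
by congr (_ * _); apply: eq_bigr => i _; rewrite pi1_map_R.
Qed.

Lemma fprod_hom_eq f f' h h' : f =1 f' -> h =1 h' -> fprod_hom f h =1 fprod_hom f' h'.
Proof. by move=> /funext -> /funext ->. Qed.

Variables (f : mcg g) (h : mcg k).

Fact fprod_bij : bijective (fprod_hom f h).
Proof.
exists (fprod_hom (f^-1 : mcg g) (h^-1 : mcg k)) => u;
  rewrite fprod_hom_comp -[RHS]fprod_hom_id; apply: fprod_hom_eq => v /=;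
  by rewrite ?mcg_invfunK ?mcg_invfunKV.
Qed.

Fact fprod_boundary : fprod_hom f h (boundary (g + k)) = boundary (g + k).
Proof.
by rewrite boundaryD gmulfM fprod_hom_l fprod_hom_r !mcg_boundary.
Qed.

Definition fprod : mcg (g + k) := Mcg fprod_bij fprod_boundary.
End FProduct.

(* The braiding beta_{r,s} as an element of mcg (r + s). The target generators
   x_(s+j), j <= r, and x_j, j <= s, are indexed by s + r, hence castC. *)
Section Beta.
Variables r s : nat.

Definition castC : 'I_(s + r) -> 'I_(r + s) := cast_ord (addnC s r).
Definition betaQ : pi1 (r + s) := \prod_(j < s) pR (castC (lshift r j)).

Definition beta_gen (z : 'I_(r + s) -> pi1 (r + s)) (i : 'I_(r + s)) :
    pi1 (r + s) :=
  match split i with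
  | inl j => betaQ * z (castC (rshift s j)) * betaQ^-1
  | inr j => z (castC (lshift r j))
  end.

Definition beta_hom : {multiplicative pi1 (r + s) -> pi1 (r + s)} :=
  pi1_hom (beta_gen (@px _)) (beta_gen (@py _)).

Lemma betaQE : betaQ = pi1_map (castC \o lshift r) (boundary s).
Proof. by rewrite mult_prod; apply: eq_bigr => i _; rewrite pi1_map_R. Qed.

Definition conjh (G : groupType) (q : G) (u : G) := q * u * q^-1.
Lemma conjh_morph (G : groupType) (q : G) : {morph conjh q : u v / u * v}.
Proof. by move=> u v; rewrite /conjh !mulgA mulgVK. Qed.
HB.instance Definition _ (G : groupType) (q : G) :=
  isMultiplicative.Build G G (conjh q) (conjh_morph q).

Lemma beta_hom_l u : beta_hom (pi1_map (lshift s) u) =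
  betaQ * pi1_map (castC \o @rshift s r) u * betaQ^-1.
Proof.
apply: (@pi1_ext2 _ _ _ _ _ _ (conjh betaQ) (pi1_map (castC \o @rshift s r)) _ _ u)
  => i; by rewrite !pi1_mapE pi1_homE /beta_gen split_l.
Qed.

Lemma beta_hom_r u : beta_hom (pi1_map (@rshift r s) u) =
  pi1_map (castC \o lshift r) u.
Proof.
by apply: pi1_ext1 u => i; rewrite !pi1_mapE pi1_homE /beta_gen split_r.
Qed.

Let castCV : 'I_(r + s) -> 'I_(s + r) := cast_ord (addnC r s).
Let Q' : pi1 (r + s) := pi1_map (@rshift r s) (boundary s).
Definition betaV_gen (z : 'I_(r + s) -> pi1 (r + s)) (i : 'I_(r + s)) :
    pi1 (r + s) :=
  match split (castCV i) with
  | inl j => z (rshift r j)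
  | inr j => Q'^-1 * z (lshift s j) * Q'
  end.
Definition betaV_hom : {multiplicative pi1 (r + s) -> pi1 (r + s)} :=
  pi1_hom (betaV_gen (@px _)) (betaV_gen (@py _)).

Lemma castCK : cancel castC castCV.
Proof. by move=> i; apply: val_inj. Qed.

Lemma betaV_hom_r u : betaV_hom (pi1_map (castC \o @rshift s r) u) =
  Q'^-1 * pi1_map (lshift s) u * Q'.
Proof.
rewrite -[X in _ = _ * X]invgK.
apply: (@pi1_ext2 _ _ _ _ _ _ (conjh Q'^-1) (pi1_map (lshift s)) _ _ u) => i;
by rewrite !pi1_mapE pi1_homE /betaV_gen [castCV _]castCK split_r -{2}(invgK Q').
Qed.

Lemma betaV_hom_l u : betaV_hom (pi1_map (castC \o lshift r) u) =
  pi1_map (@rshift r s) u.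
Proof.
by apply: pi1_ext1 u => i;
  rewrite !pi1_mapE pi1_homE /betaV_gen [castCV _]castCK split_l.
Qed.

Lemma pi1_ext_splitC (G : groupType) (f h : {multiplicative pi1 (r + s) -> G}) :
  (forall u, f (pi1_map (castC \o lshift r) u) = h (pi1_map (castC \o lshift r) u)) ->
  (forall u, f (pi1_map (castC \o @rshift s r) u) =
             h (pi1_map (castC \o @rshift s r) u)) -> f =1 h.
Proof.
move=> fl fr u.
have -> : u = pi1_map castC (pi1_map castCV u).
  by rewrite pi1_map_comp pi1_map_id // => i; apply: val_inj.
by apply: pi1_ext_split2 => v; rewrite pi1_map_comp ?fl ?fr.
Qed.

Lemma pi1_ext_splitC1 (G1 G : groupType)
    (f : {multiplicative G1 -> G}) (f' : {multiplicative pi1 (r + s) -> G1})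
    (h : {multiplicative pi1 (r + s) -> G}) :
  (forall u, f (f' (pi1_map (castC \o lshift r) u)) =
             h (pi1_map (castC \o lshift r) u)) ->
  (forall u, f (f' (pi1_map (castC \o @rshift s r) u)) =
             h (pi1_map (castC \o @rshift s r) u)) ->
  forall u, f (f' u) = h u.
Proof. exact: (@pi1_ext_splitC G (f \o f') h). Qed.

Fact beta_bij : bijective beta_hom.
Proof.
exists betaV_hom.
  apply: (@pi1_ext_split1 _ _ _ _ _ _ idfun) => u; last by rewrite beta_hom_r betaV_hom_l.
  rewrite beta_hom_l !gmulfM multV betaV_hom_r betaQE betaV_hom_l -/Q'.
  by rewrite !mulgA mulgV mul1g mulgK.
apply: (@pi1_ext_splitC1 _ _ _ _ idfun) => u; first by rewrite betaV_hom_l beta_hom_r.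
rewrite betaV_hom_r !gmulfM multV beta_hom_l beta_hom_r -betaQE.
by rewrite !mulgA mulVg mul1g mulgVK.
Qed.

Fact beta_boundary : beta_hom (boundary (r + s)) = boundary (r + s).
Proof.
rewrite {1}boundaryD gmulfM beta_hom_l beta_hom_r -betaQE mulgVK.
by rewrite -(pi1_map_boundary (addnC s r)) boundaryD gmulfM !pi1_map_comp betaQE.
Qed.

Definition beta : mcg (r + s) := Mcg beta_bij beta_boundary.
End Beta.

Section FProductTensor.

Fact fprod1 m n : fprod (1 : mcg m) (1 : mcg n) = 1.
Proof. by apply: mcg_ext; apply: fprod_hom_id. Qed.

Fact fprodM m n (x x' : mcg m) (y y' : mcg n) :
  fprod (x * x') (y * y') = fprod x y * fprod x' y'.
Proof. by apply: mcg_ext => u; apply/esym/fprod_hom_comp. Qed.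

Definition act a b (f : @hom (coprod mcg) a b) : {multiplicative pi1 a -> pi1 b} :=
  match f in coprod_hom _ a b return {multiplicative pi1 a -> pi1 b} with
  | EndHom _ x => mcg_hom x
  end.

Lemma act_comp a b c (f : @hom (coprod mcg) a b) (g : @hom (coprod mcg) b c) u :
  act (f \; g) u = act g (act f u).
Proof. by case: f g u => n x g; case: g x => m y x u. Qed.

Lemma act_eqhom a b (e : a = b) u : act (@eqhom mcg a b e) u = pi1_map (cast_ord e) u.
Proof.
by case: b / e => /=; rewrite pi1_map_id // => i; apply: val_inj.
Qed.

Lemma act_inj a b (f g : @hom (coprod mcg) a b) : act f =1 act g -> f = g.
Proof.
have H (e : a = b) (x y : mcg a) :
    act ((EndHom x : @hom (coprod mcg) a a) \; eqhom e) =1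
    act ((EndHom y : @hom (coprod mcg) a a) \; eqhom e) -> x = y.
  by case: b / e {f g} => E; apply: mcg_ext => u; have := E u; rewrite !act_comp.
rewrite (homE f) (homE g) (eqhom_irr (hom_eq g) (hom_eq f)) => /H.
by move=> ->.
Qed.

Lemma act_boundary a b (f : @hom (coprod mcg) a b) : act f (boundary a) = boundary b.
Proof. by case: f => n x; apply: mcg_boundary. Qed.

Lemma pi1_map_eq m n (s t : 'I_m -> 'I_n) : s =1 t -> pi1_map s =1 pi1_map t.
Proof. by move=> /funext ->. Qed.

Section Assoc.
Variables l m n : nat.
Let cA := cast_ord (esym (addnA l m n)).
Let cV := cast_ord (addnA l m n).
Lemma assoc1 u : pi1_map cA (pi1_map (lshift n) (pi1_map (lshift m) u)) =
  pi1_map (lshift (m + n)) u.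
Proof. by rewrite !pi1_map_comp; apply: pi1_map_eq => i; apply: val_inj. Qed.
Lemma assoc2 u : pi1_map cA (pi1_map (lshift n) (pi1_map (@rshift l m) u)) =
  pi1_map (@rshift l (m + n)) (pi1_map (lshift n) u).
Proof. by rewrite !pi1_map_comp; apply: pi1_map_eq => i; apply: val_inj. Qed.
Lemma assoc3 u : pi1_map cA (pi1_map (@rshift (l + m) n) u) =
  pi1_map (@rshift l (m + n)) (pi1_map (@rshift m n) u).
Proof.
by rewrite !pi1_map_comp; apply: pi1_map_eq => i; apply: val_inj; rewrite /= addnA.
Qed.
Lemma assocV1 u : pi1_map cV (pi1_map (lshift (m + n)) u) =
  pi1_map (lshift n) (pi1_map (lshift m) u).
Proof. by rewrite !pi1_map_comp; apply: pi1_map_eq => i; apply: val_inj. Qed.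
Lemma assocV2 u : pi1_map cV (pi1_map (@rshift l (m + n)) (pi1_map (lshift n) u)) =
  pi1_map (lshift n) (pi1_map (@rshift l m) u).
Proof. by rewrite !pi1_map_comp; apply: pi1_map_eq => i; apply: val_inj. Qed.
Lemma assocV3 u : pi1_map cV (pi1_map (@rshift l (m + n)) (pi1_map (@rshift m n) u))
  = pi1_map (@rshift (l + m) n) u.
Proof.
by rewrite !pi1_map_comp; apply: pi1_map_eq => i; apply: val_inj; rewrite /= addnA.
Qed.

Lemma pi1_ext_split3 (G1 G2 G : groupType)
    (f : {multiplicative G1 -> G}) (f' : {multiplicative pi1 (l + m + n) -> G1})
    (h : {multiplicative G2 -> G}) (h' : {multiplicative pi1 (l + m + n) -> G2}) :
  (forall u, f (f' (pi1_map (lshift n) (pi1_map (lshift m) u))) =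
             h (h' (pi1_map (lshift n) (pi1_map (lshift m) u)))) ->
  (forall u, f (f' (pi1_map (lshift n) (pi1_map (@rshift l m) u))) =
             h (h' (pi1_map (lshift n) (pi1_map (@rshift l m) u)))) ->
  (forall u, f (f' (pi1_map (@rshift (l + m) n) u)) =
             h (h' (pi1_map (@rshift (l + m) n) u))) ->
  forall u, f (f' u) = h (h' u).
Proof.
move=> h1 h2 h3; apply: pi1_ext_split2 => // u.
apply: (@pi1_ext_split2 _ _ _ _ _ f (f' \o pi1_map (lshift n))
                                  h (h' \o pi1_map (lshift n))) => v.
- exact: h1.
- exact: h2.
Qed.
End Assoc.

Fact fprodA l m n (x : mcg l) (y : mcg m) (z : mcg n) :
  (EndHom (fprod (fprod x y) z) : @hom (coprod mcg) _ _) \; eqhom (esym (addnA l m n)) =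
  eqhom (esym (addnA l m n)) \; EndHom (fprod x (fprod y z)).
Proof.
apply: act_inj => u; rewrite !act_comp !act_eqhom; move: u.
apply: pi1_ext_split3 => u /=.
- by rewrite !(fprod_hom_l, assoc1).
- by rewrite !(fprod_hom_l, fprod_hom_r, assoc2).
- by rewrite !(fprod_hom_r, assoc3).
Qed.

Fact fprod_l n (x : mcg n) :
  (EndHom (fprod (1 : mcg 0) x) : @hom (coprod mcg) _ _) \; eqhom (add0n n) =
  eqhom (add0n n) \; EndHom x.
Proof.
apply: act_inj => u; rewrite !act_comp !act_eqhom; move: u.
have E v : pi1_map (cast_ord (add0n n)) (pi1_map (@rshift 0 n) v) = v.
  by rewrite pi1_map_comp pi1_map_id // => i; apply: val_inj.
apply: pi1_ext_split2 => u /=; last by rewrite fprod_hom_r !E.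
by move: u; apply: (@pi1_ext2 0 _ _ _ _ (_ \o _) _ (_ \o _)); case.
Qed.

Fact fprod_r n (x : mcg n) :
  (EndHom (fprod x (1 : mcg 0)) : @hom (coprod mcg) _ _) \; eqhom (addn0 n) =
  eqhom (addn0 n) \; EndHom x.
Proof.
apply: act_inj => u; rewrite !act_comp !act_eqhom; move: u.
have E v : pi1_map (cast_ord (addn0 n)) (pi1_map (lshift 0) v) = v.
  by rewrite pi1_map_comp pi1_map_id // => i; apply: val_inj.
apply: pi1_ext_split2 => u /=; first by rewrite fprod_hom_l !E.
by move: u; apply: (@pi1_ext2 0 _ _ _ _ (_ \o _) _ (_ \o _)); case.
Qed.

End FProductTensor.

Definition fprod_tensor : tensor_axioms fprod :=
  TensorAxioms fprod1 fprodM fprodA fprod_l fprod_r.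

Definition mcg_monoidal : monoidal_category := coprod_monoidal fprod_tensor.

(* The element beta r s of mcg (r + s), read as a morphism r + s -> s + r. *)
Definition mcg_braiding (r s : mcg_monoidal) :
    @hom mcg_monoidal (r \tens s) (s \tens r) :=
  (EndHom (beta r s) : @hom (coprod mcg) _ _) \; eqhom (addnC r s).

Section BraidingM.
Implicit Types a b c : nat.

Lemma act_tens_l a b a' b' (f : @hom mcg_monoidal a a') (g : @hom mcg_monoidal b b') u :
  act (f \tensm g) (pi1_map (lshift b) u) = pi1_map (lshift b') (act f u).
Proof. by case: f u => n x u; case: g => m y; apply: fprod_hom_l. Qed.
Lemma act_tens_r a b a' b' (f : @hom mcg_monoidal a a') (g : @hom mcg_monoidal b b') u :
  act (f \tensm g) (pi1_map (@rshift a b) u) = pi1_map (@rshift a' b') (act g u).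
Proof. by case: g u => m y u; case: f => n x; apply: fprod_hom_r. Qed.
Definition act_tens := (act_tens_l, act_tens_r).
Lemma act_idm a u : act (idm (a : mcg_monoidal)) u = u.
Proof. by []. Qed.
Lemma act_massoc a b c u :
  act (massoc (a : mcg_monoidal) b c) u = pi1_map (cast_ord (esym (addnA a b c))) u.
Proof. exact: act_eqhom. Qed.
Lemma act_massocV a b c u :
  act (massocV (a : mcg_monoidal) b c) u = pi1_map (cast_ord (addnA a b c)) u.
Proof. exact: act_eqhom. Qed.

Lemma act_braid_l a b u : act (mcg_braiding a b) (pi1_map (lshift b) u) =
  pi1_map (lshift a) (boundary b) * pi1_map (@rshift b a) u *
  (pi1_map (lshift a) (boundary b))^-1.
Proof.
rewrite act_comp act_eqhom /= beta_hom_l !gmulfM multV betaQE !pi1_map_comp.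
by congr (_ * _ * _^-1); apply: pi1_map_eq => i; apply: val_inj.
Qed.
Lemma act_braid_r a b u : act (mcg_braiding a b) (pi1_map (@rshift a b) u) =
  pi1_map (lshift a) u.
Proof.
rewrite act_comp act_eqhom /= beta_hom_r !pi1_map_comp.
by apply: pi1_map_eq => i; apply: val_inj.
Qed.

Lemma act_inj_split a b c (f g : @hom (coprod mcg) (a + b)%N c) :
  (forall u, act f (pi1_map (lshift b) u) = act g (pi1_map (lshift b) u)) ->
  (forall u, act f (pi1_map (@rshift a b) u) = act g (pi1_map (@rshift a b) u)) ->
  f = g.
Proof. by move=> fl fr; apply: act_inj; apply: pi1_ext_split. Qed.

Lemma act_inj_split3l a b c d (f g : @hom (coprod mcg) (a + b + c)%N d) :
  (forall u, act f (pi1_map (lshift c) (pi1_map (lshift b) u)) =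
             act g (pi1_map (lshift c) (pi1_map (lshift b) u))) ->
  (forall u, act f (pi1_map (lshift c) (pi1_map (@rshift a b) u)) =
             act g (pi1_map (lshift c) (pi1_map (@rshift a b) u))) ->
  (forall u, act f (pi1_map (@rshift (a + b) c) u) =
             act g (pi1_map (@rshift (a + b) c) u)) -> f = g.
Proof. by move=> h1 h2 h3; apply: act_inj_split => //; apply: pi1_ext_split2. Qed.

Lemma act_inj_split3r a b c d (f g : @hom (coprod mcg) (a + (b + c))%N d) :
  (forall u, act f (pi1_map (lshift (b + c)) u) =
             act g (pi1_map (lshift (b + c)) u)) ->
  (forall u, act f (pi1_map (@rshift a (b + c)) (pi1_map (lshift c) u)) =
             act g (pi1_map (@rshift a (b + c)) (pi1_map (lshift c) u))) ->
  (forall u, act f (pi1_map (@rshift a (b + c)) (pi1_map (@rshift b c) u)) =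
             act g (pi1_map (@rshift a (b + c)) (pi1_map (@rshift b c) u))) -> f = g.
Proof. by move=> h1 h2 h3; apply: act_inj_split => //; apply: pi1_ext_split2. Qed.

(* The laws only depend on the action, described by act_braid_l and
   act_braid_r. *)
Section BraidingLaws.
Variable br : forall a b : mcg_monoidal, @hom mcg_monoidal (a \tens b) (b \tens a).
Hypothesis br_l : forall a b u, act (br a b) (pi1_map (lshift b) u) =
  pi1_map (lshift a) (boundary b) * pi1_map (@rshift b a) u *
  (pi1_map (lshift a) (boundary b))^-1.
Hypothesis br_r : forall a b u, act (br a b) (pi1_map (@rshift a b) u) =
  pi1_map (lshift a) u.

Lemma br_nat (a b a' b' : mcg_monoidal) (f : hom a a') (g : hom b b') :
  (f \tensm g) \; br a' b' = br a b \; (g \tensm f).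
Proof.
apply: (@act_inj_split a b) => u; rewrite !act_comp act_tens ?br_l ?br_r.
  by rewrite !gmulfM multV !act_tens act_boundary.
by rewrite act_tens.
Qed.

Lemma br_hexagon (a b c : mcg_monoidal) :
  massoc a b c \; br a (b \tens c) \; massoc b c a =
  (br a b \tensm idm c) \; massoc b a c \; (idm b \tensm br a c).
Proof.
apply: (@act_inj_split3l a b c) => u; rewrite !(act_comp, act_massoc).
- rewrite assoc1 br_l act_tens_l br_l.
  rewrite !gmulfM !multV boundaryD !gmulfM assoc1 assoc2 assoc3.
  by rewrite assoc1 assoc2 !act_tens act_idm br_l !gmulfM multV !invgM !mulgA.
- by rewrite assoc2 br_r assoc1 act_tens_l br_r assoc1
             act_tens_l.
- by rewrite assoc3 br_r assoc2 act_tens_r assoc3 act_tens_r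
             br_r.
Qed.

Lemma br_hexagonV (a b c : mcg_monoidal) :
  massocV a b c \; br (a \tens b) c \; massocV c a b =
  (idm a \tensm br b c) \; massocV a c b \; (br a c \tensm idm b).
Proof.
apply: (@act_inj_split3r a b c) => u; rewrite !(act_comp, act_massocV).
- rewrite assocV1 br_l !gmulfM multV assocV1 assocV2.
  by rewrite act_tens_l assocV1 act_tens_l br_l !gmulfM multV.
- rewrite assocV2 br_l !gmulfM multV assocV1 assocV3.
  by rewrite act_tens_r br_l !gmulfM !multV assocV2 assocV3 !act_tens br_r.
- by rewrite assocV3 br_r assocV1 act_tens_r br_r assocV2
             act_tens_l br_r.
Qed.
End BraidingLaws.
End BraidingM.

Definition mcg_braided : braided_category :=
  @BraidedCategory mcg_monoidal mcg_braiding (fun a b => coprod_iso (mcg_braiding a b))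
    (br_nat act_braid_l act_braid_r) (br_hexagon act_braid_l act_braid_r)
    (br_hexagonV act_braid_l act_braid_r).

Section BraidGroup.
Variable n : nat.

(* The letter i < n - 1 stands for sigma_(i+1). *)
Inductive braid_rel : word 'I_n.-1 -> word 'I_n.-1 -> Prop :=
| BraidComm (i j : 'I_n.-1) : (i.+1 < j)%N ->
    braid_rel [:: (i, false); (j, false)] [:: (j, false); (i, false)]
| BraidBraid (i j : 'I_n.-1) : j = i.+1 :> nat ->
    braid_rel [:: (i, false); (j, false); (i, false)]
              [:: (j, false); (i, false); (j, false)].

Definition braid_group : groupType := presented braid_rel.

Definition sigma (i : 'I_n.-1) : braid_group := pres_gen braid_rel i.

Section BraidHom.
Variables (G : groupType) (f : 'I_n.-1 -> G).
Hypothesis fC : forall i j : 'I_n.-1, (i.+1 < j)%N -> f i * f j = f j * f i.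
Hypothesis fB : forall i j : 'I_n.-1, j = i.+1 :> nat ->
  f i * f j * f i = f j * f i * f j.

Fact braid_hom_rel r1 r2 : braid_rel r1 r2 -> word_eval f r1 = word_eval f r2.
Proof.
by case=> i j ij; rewrite /word_eval !big_cons !big_nil /= !mulg1 ?mulgA ?(fC ij) ?(fB ij).
Qed.

Definition braid_hom : {multiplicative braid_group -> G} := pres_lift braid_hom_rel.

Lemma braid_hom_sigma i : braid_hom (sigma i) = f i.
Proof. exact: pres_lift_gen. Qed.
End BraidHom.

Lemma sigmaC (i j : 'I_n.-1) : (i.+1 < j)%N -> sigma i * sigma j = sigma j * sigma i.
Proof.
move=> ij; rewrite [LHS]pres_mulE [RHS]pres_mulE; apply/pres_eqP.
exact: (PresRel [::] [::] (BraidComm ij)).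
Qed.

Lemma sigmaB (i j : 'I_n.-1) : j = i.+1 :> nat ->
  sigma i * sigma j * sigma i = sigma j * sigma i * sigma j.
Proof.
move=> ij; rewrite [X in X * _]pres_mulE [LHS]pres_mulE.
rewrite [X in _ = X * _]pres_mulE [RHS]pres_mulE; apply/pres_eqP.
exact: (PresRel [::] [::] (BraidBraid ij)).
Qed.

Lemma braid_ext (G : groupType) (f h : {multiplicative braid_group -> G}) :
  (forall i, f (sigma i) = h (sigma i)) -> f =1 h.
Proof. exact: pres_hom_ext. Qed.
End BraidGroup.

Fact shift_ord_subproof c m n (le_cm_n : (c + m <= n)%N) (i : 'I_m.-1) :
  (c + i < n.-1)%N.
Proof. by case: i => i /= ?; lia. Qed.
Definition shift_ord c m n (le_cm_n : (c + m <= n)%N) (i : 'I_m.-1) : 'I_n.-1 :=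
  Ordinal (shift_ord_subproof le_cm_n i).

Section BraidShift.
Variables (c m n : nat) (le_cm_n : (c + m <= n)%N).

Fact shift_comm (i j : 'I_m.-1) : (i.+1 < j)%N ->
  sigma (shift_ord le_cm_n i) * sigma (shift_ord le_cm_n j) =
  sigma (shift_ord le_cm_n j) * sigma (shift_ord le_cm_n i).
Proof. by move=> ij; apply: sigmaC; rewrite /= -addnS ltn_add2l. Qed.
Fact shift_braid (i j : 'I_m.-1) : j = i.+1 :> nat ->
  sigma (shift_ord le_cm_n i) * sigma (shift_ord le_cm_n j)
    * sigma (shift_ord le_cm_n i) =
  sigma (shift_ord le_cm_n j) * sigma (shift_ord le_cm_n i)
    * sigma (shift_ord le_cm_n j).
Proof. by move=> ij; apply: sigmaB; rewrite /= ij addnS. Qed.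

Definition bshift : {multiplicative braid_group m -> braid_group n} :=
  braid_hom shift_comm shift_braid.

Lemma bshift_sigma i : bshift (sigma i) = sigma (shift_ord le_cm_n i).
Proof. exact: braid_hom_sigma. Qed.
End BraidShift.

Definition juxtapose m n (a : braid_group m) (b : braid_group n) :
    braid_group (m + n) :=
  bshift (leq_addr n m : (0 + m <= m + n)%N) a * bshift (leqnn (m + n)) b.

(* sigma_{r,s} is the product over k < s of the words
   sigma_(r+k) ... sigma_(k+1), where the letter i < r is sigma_(r+k-i), that is,
   sigma applied to the 0-based index k + (r - i - 1). *)
Section Block.
Variables r s : nat.

Fact block_ord_subproof (k : 'I_s) (i : 'I_r) : (k + rev_ord i < (r + s).-1)%N.
Proof. by case: k i => k ? [i ?] /=; lia. Qed.
Definition block_ord (k : 'I_s) (i : 'I_r) : 'I_(r + s).-1 :=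
  Ordinal (block_ord_subproof k i).

Definition sigma_block : braid_group (r + s) :=
  \prod_(k < s) \prod_(i < r) sigma (block_ord k i).
End Block.

Section BraidCalculus.
Variable n : nat.
Definition sg (k : nat) : braid_group n :=
  if insub k is Some i then sigma i else 1.

Lemma sgE (i : 'I_n.-1) : sigma i = sg i.
Proof. by rewrite /sg valK. Qed.

Lemma sgC i j : (i.+1 < j)%N -> commute (sg i) (sg j).
Proof.
rewrite /sg => ij; case: insubP => [i' _ Ei|_]; last exact/commute_sym/commute1.
by case: insubP => [j' _ Ej|_]; [apply: sigmaC; rewrite Ei Ej | apply: commute1].
Qed.

Lemma sgC' i j : (i.+1 < j)%N || (j.+1 < i)%N -> commute (sg i) (sg j).
Proof. by case/orP=> /sgC // /commute_sym. Qed.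

Lemma sgB i : (i.+2 < n)%N -> sg i * sg i.+1 * sg i = sg i.+1 * sg i * sg i.+1.
Proof.
move=> lt; have li : (i < n.-1)%N by lia.
have lj : (i.+1 < n.-1)%N by lia.
by rewrite -[i]/(val (Ordinal li)) -[(val (Ordinal li)).+1]/(val (Ordinal lj)) -!sgE
  sigmaB.
Qed.

Definition Dw k r := \prod_(i < r) sg (k + rev_ord i).
Definition Bw c r s := \prod_(k < s) Dw (c + k) r.

Lemma DwS k r : Dw k r.+1 = sg (k + r) * Dw k r.
Proof.
by rewrite /Dw big_ord_recl; congr (sg _ * _); rewrite /= subn1.
Qed.

Lemma Dw0 k : Dw k 0 = 1. Proof. exact: big_ord0. Qed.

Lemma DwC j k r : (j.+1 < k)%N || (k + r < j)%N -> commute (sg j) (Dw k r).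
Proof.
move=> h; apply: commute_prod => -[i lti] _; apply: sgC' => /=; lia.
Qed.

Lemma BwS c r s : Bw c r s.+1 = Bw c r s * Dw (c + s) r.
Proof. by rewrite /Bw big_ord_recr. Qed.

Lemma Dw_shift j k r : (k <= j)%N -> (j.+1 < k + r)%N -> (k + r < n)%N ->
  sg j * Dw k r = Dw k r * sg j.+1.
Proof.
elim: r => [|r ih] kj jr rn; first by lia.
rewrite DwS; case: (ltngtP j.+1 (k + r)%N) => h; last first.
- case: r => [|r] in ih jr rn h *; first by lia.
  have -> : (k + r.+1 = j.+1)%N by lia.
  have -> : Dw k r.+1 = sg j * Dw k r by rewrite DwS; congr (sg _ * _); lia.
  rewrite !mulgA sgB; last by lia.
  by rewrite -!mulgA DwC //; lia.
- lia.
- rewrite mulgA sgC; last by lia.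
  by rewrite -!mulgA ih //; lia.
Qed.

Lemma Bw_shift j c r s : (c <= j)%N -> (j.+1 < c + r)%N -> (c + r + s <= n)%N ->
  sg j * Bw c r s = Bw c r s * sg (j + s).
Proof.
move=> cj jr; elim: s => [|s ih] sn.
  by rewrite /Bw big_ord0 mulg1 mul1g addn0.
rewrite BwS mulgA ih; last by lia.
by rewrite -!mulgA Dw_shift ?addnS //; lia.
Qed.

Lemma DwD k r1 r2 : Dw k (r1 + r2) = Dw (k + r1) r2 * Dw k r1.
Proof.
elim: r2 => [|r2 ih]; first by rewrite addn0 Dw0 mul1g.
by rewrite addnS !DwS ih mulgA addnA.
Qed.

Lemma Bw_Dw_comm c r s k t : (c + s + r <= k)%N -> commute (Bw c r s) (Dw k t).
Proof.
move=> le; apply/commute_sym/commute_prod => -[i lti] _.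
apply/commute_sym/commute_prod => -[j ltj] _ /=.
by apply/commute_sym/DwC; lia.
Qed.

Lemma BwDl c r1 r2 s : Bw c (r1 + r2) s = Bw (c + r1) r2 s * Bw c r1 s.
Proof.
elim: s => [|s ih]; first by rewrite /Bw !big_ord0 mulg1.
rewrite !BwS ih DwD (_ : c + r1 + s = c + s + r1)%N; last by lia.
rewrite -!mulgA; congr (_ * _); rewrite !mulgA; congr (_ * _).
exact: Bw_Dw_comm.
Qed.

Lemma BwDr c r s1 s2 : Bw c r (s1 + s2) = Bw c r s1 * Bw (c + s1) r s2.
Proof.
rewrite /Bw big_split_ord /=; congr (_ * _).
by apply: eq_bigr => i _; rewrite addnA.
Qed.

Lemma Bw_shift1 j k s : (j.+1 < s)%N -> (k + s < n)%N ->
  sg (k + j.+1) * Bw k 1 s = Bw k 1 s * sg (k + j).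
Proof.
have D1 i : Dw i 1 = sg i by rewrite DwS Dw0 mulg1 addn0.
elim: s => [//|s ih] js sn; rewrite BwS D1.
case: (ltngtP j.+1 s) => h; last first.
- subst s; rewrite BwS D1.
  have C : commute (sg (k + j.+1)) (Bw k 1 j).
    by apply: commute_prod => -[i lti] _; rewrite D1; apply: sgC' => /=; lia.
  by rewrite !mulgA C -!mulgA; congr (_ * _); rewrite !mulgA addnS sgB //; lia.
- lia.
- rewrite mulgA ih //; last by lia.
  by rewrite -!mulgA sgC //; lia.
Qed.

Lemma Bw_shiftr j c r s : (j.+1 < s)%N -> (c + r + s <= n)%N ->
  sg (c + r + j) * Bw c r s = Bw c r s * sg (c + j).
Proof.
move=> js; elim: r => [|r ih] rn.
  by rewrite /Bw big1 ?mulg1 ?mul1g ?addn0 // => i _; rewrite Dw0.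
rewrite -addn1 BwDl mulgA (_ : c + (r + 1) + j = c + r + j.+1)%N; last by lia.
rewrite Bw_shift1 //; last by lia.
by rewrite -!mulgA ih //; lia.
Qed.
End BraidCalculus.

Lemma bshift_sg c m n (le : (c + m <= n)%N) k : (k < m.-1)%N ->
  bshift le (sg m k) = sg n (c + k).
Proof. by move=> lt; rewrite -[k]/(val (Ordinal lt)) -sgE bshift_sigma sgE. Qed.

Lemma bshift_block c r s n (le : (c + (r + s) <= n)%N) :
  bshift le (sigma_block r s) = Bw n c r s.
Proof.
rewrite mult_prod; apply: eq_bigr => k _; rewrite mult_prod.
by apply: eq_bigr => i _; rewrite bshift_sigma sgE /= addnA.
Qed.

Lemma sigma_blockE r s : sigma_block r s = Bw (r + s) 0 r s.
Proof.
by apply: eq_bigr => k _; apply: eq_bigr => i _; rewrite sgE.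
Qed.

Fact bshift_comp_le c c' m n p :
  (c + m <= n)%N -> (c' + n <= p)%N -> (c' + c + m <= p)%N.
Proof. by lia. Qed.
Lemma bshift_comp c c' m n p (le : (c + m <= n)%N) (le' : (c' + n <= p)%N) u :
  bshift le' (bshift le u) = bshift (bshift_comp_le le le') u.
Proof.
set le'' := bshift_comp_le le le'.
apply: (@braid_ext m _ (bshift le' \o bshift le) (bshift le'')) => i.
rewrite -[LHS]/(bshift le' (bshift le (sigma i))) !bshift_sigma; congr sigma.
by apply: val_inj; rewrite /= addnA.
Qed.

Lemma bshift_id m (le : (0 + m <= m)%N) u : bshift le u = u.
Proof.
apply: (@braid_ext m _ (bshift le) idfun) => i; rewrite bshift_sigma.
by congr sigma; apply: val_inj.
Qed.

Lemma bshift_irr c c' m n (le : (c + m <= n)%N) (le' : (c' + m <= n)%N) u :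
  c = c' -> bshift le u = bshift le' u.
Proof. by move=> e; case: c' / e in le' *; rewrite (bool_irrelevance le le'). Qed.

Lemma castG_bshift m n (e : m = n) (le : (0 + m <= n)%N) u :
  castG e u = bshift le u.
Proof. by case: n / e in le *; rewrite bshift_id. Qed.

Lemma bshift_commute c c' m m' n (le : (c + m <= n)%N) (le' : (c' + m' <= n)%N) u v :
  (c + m <= c')%N -> commute (bshift le u) (bshift le' v).
Proof.
move=> cm.
have H i w : commute (bshift le (sigma i)) (bshift le' w).
  elim/pres_ind: w => [|j w ih|j w ih].
  - by rewrite mult1; apply: commute1.
  - rewrite gmulfM; apply: commuteM => //; rewrite -[pres_gen _ j]/(sigma j).
    by rewrite !bshift_sigma !sgE; apply: sgC => /=; have := ltn_ord i; lia.
  - rewrite gmulfM multV; apply: commuteM => //; rewrite -[pres_gen _ j]/(sigma j).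
    apply: commuteV.
    by rewrite !bshift_sigma !sgE; apply: sgC => /=; have := ltn_ord i; lia.
elim/pres_ind: u => [|j w ih|j w ih].
- by rewrite mult1; apply/commute_sym/commute1.
- by rewrite gmulfM; apply/commute_sym/commuteM; apply/commute_sym; [apply: H | apply: ih].
- rewrite gmulfM multV; apply/commute_sym/commuteM; last exact/commute_sym/ih.
  by apply/commuteV/commute_sym/H.
Qed.

Section Juxtapose.
Fact juxtapose1 m n : juxtapose (1 : braid_group m) (1 : braid_group n) = 1.
Proof. by rewrite /juxtapose !mult1 mulg1. Qed.

Fact juxtaposeM m n (x x' : braid_group m) (y y' : braid_group n) :
  juxtapose (x * x') (y * y') = juxtapose x y * juxtapose x' y'.
Proof.
rewrite /juxtapose !gmulfM -!mulgA; congr (_ * _); rewrite !mulgA; congr (_ * _).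
exact: bshift_commute.
Qed.

Fact juxtaposeA l m n (x : braid_group l) (y : braid_group m) (z : braid_group n) :
  (EndHom (juxtapose (juxtapose x y) z) : @hom (coprod braid_group) _ _) \;
    eqhom (esym (addnA l m n)) =
  eqhom (esym (addnA l m n)) \; EndHom (juxtapose x (juxtapose y z)).
Proof.
apply: hom_val_inj; rewrite !hom_val_comp !hom_val_eqhom mul1g /=.
have le : (0 + (l + (m + n)) <= l + m + n)%N by lia.
rewrite mulg1 (castG_bshift _ le) /juxtapose !gmulfM !mulgA.
by congr (_ * _ * _); rewrite !bshift_comp; apply: bshift_irr; lia.
Qed.

Fact juxtapose_l n (x : braid_group n) :
  (EndHom (juxtapose (1 : braid_group 0) x) : @hom (coprod braid_group) _ _) \;
    eqhom (add0n n) = eqhom (add0n n) \; EndHom x.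
Proof.
apply: hom_val_inj; rewrite !hom_val_comp !hom_val_eqhom mul1g /=.
rewrite mulg1 (castG_bshift _ (leqnn n)) /juxtapose mult1 mul1g.
exact: bshift_irr.
Qed.

Fact juxtapose_r n (x : braid_group n) :
  (EndHom (juxtapose x (1 : braid_group 0)) : @hom (coprod braid_group) _ _) \;
    eqhom (addn0 n) = eqhom (addn0 n) \; EndHom x.
Proof.
apply: hom_val_inj; rewrite !hom_val_comp !hom_val_eqhom mul1g /=.
rewrite mulg1 (castG_bshift _ (leq_addr 0 n : (0 + n <= n + 0)%N)).
by rewrite /juxtapose mult1 mulg1.
Qed.
End Juxtapose.

Definition juxtapose_tensor : tensor_axioms juxtapose :=
  TensorAxioms juxtapose1 juxtaposeM juxtaposeA juxtapose_l juxtapose_r.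

Definition braid_monoidal : monoidal_category := coprod_monoidal juxtapose_tensor.

Definition braid_braiding (r s : braid_monoidal) :
    @hom braid_monoidal (r \tens s) (s \tens r) :=
  (EndHom (sigma_block r s) : @hom (coprod braid_group) _ _) \; eqhom (addnC r s).

Section BraidingB.

Lemma hom_val_braiding r s : hom_val (braid_braiding r s) = sigma_block r s.
Proof. by rewrite hom_val_comp hom_val_eqhom /= mulg1. Qed.

Lemma hom_val_tensm (a b a' b' : braid_monoidal) (f : hom a a') (g : hom b b') :
  hom_val (f \tensm g : @hom braid_monoidal _ _) = juxtapose (hom_val f) (hom_val g).
Proof. by case: f => n x; case: g => m y. Qed.

Lemma castG1 m n (e : m = n) : castG e (1 : braid_group m) = 1.
Proof. by case: n / e. Qed.

Lemma castGM m n (e : m = n) (x y : braid_group m) :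
  castG e (x * y) = castG e x * castG e y.
Proof. by case: n / e. Qed.

Lemma castG_shift_block c r s m n (e : m = n) (le : (c + (r + s) <= m)%N) :
  castG e (bshift le (sigma_block r s)) = Bw n c r s.
Proof. by case: n / e; rewrite bshift_block. Qed.

Lemma castG_Bw c r s m n (e : m = n) : castG e (Bw m c r s) = Bw n c r s.
Proof. by case: n / e. Qed.

Lemma castG_block r s n (e : (r + s)%N = n) :
  castG e (sigma_block r s) = Bw n 0 r s.
Proof. by case: n / e; rewrite sigma_blockE. Qed.

Lemma block_nat r s (x : braid_group r) (y : braid_group s)
    (e : (s + r)%N = (r + s)%N) :
  juxtapose x y * sigma_block r s = sigma_block r s * castG e (juxtapose y x).
Proof.
have le0 : (0 + (s + r) <= r + s)%N by lia.
rewrite (castG_bshift _ le0) /juxtapose gmulfM !bshift_comp.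
rewrite (bshift_commute (leq_addr s r : (0 + r <= r + s)%N) (leqnn (r + s)) x y (leqnn r)).
rewrite -mulgA.
set W := sigma_block r s.
have Hx : bshift (leq_addr s r : (0 + r <= r + s)%N) x * W =
          W * bshift (bshift_comp_le (leqnn (s + r)) le0) x.
  have E := @braid_ext r _ (conjh W^-1 \o bshift (leq_addr s r : (0 + r <= r + s)%N))
    (bshift (bshift_comp_le (leqnn (s + r)) le0)) _ x.
  rewrite -E; first by rewrite /= /conjh invgK -mulgA mulVKg.
  move=> j /=; rewrite /conjh invgK.
  apply: (mulgI W); rewrite -mulgA mulVKg !bshift_sigma !sgE /=.
  rewrite /W sigma_blockE Bw_shift //; last by have := ltn_ord j; lia.
  by congr (_ * sg _ _); lia.
rewrite Hx mulgA [RHS]mulgA; congr (_ * _).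
have E := @braid_ext s _ (conjh W^-1 \o bshift (leqnn (r + s)))
  (bshift (bshift_comp_le (leq_addr r s : (0 + s <= s + r)%N) le0)) _ y.
rewrite -E; first by rewrite /= /conjh invgK -mulgA mulVKg.
move=> j /=; rewrite /conjh invgK.
apply: (mulgI W); rewrite -mulgA mulVKg !bshift_sigma !sgE /=.
rewrite /W sigma_blockE -(@Bw_shiftr _ _ 0) ?add0n //.
by have := ltn_ord j; lia.
Qed.

Fact braid_braiding_nat (a b a' b' : braid_monoidal) (f : hom a a') (g : hom b b') :
  (f \tensm g) \; braid_braiding a' b' = braid_braiding a b \; (g \tensm f).
Proof.
apply: hom_val_inj; rewrite [LHS]hom_val_comp [RHS]hom_val_comp.
rewrite !hom_val_braiding; case: f => r x; case: g => s y.
exact: block_nat.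
Qed.

Fact braid_hexagon (a b c : braid_monoidal) :
  massoc a b c \; braid_braiding a (b \tens c) \; massoc b c a =
  (braid_braiding a b \tensm idm c) \; massoc b a c \; (idm b \tensm braid_braiding a c).
Proof.
apply: hom_val_inj.
rewrite [LHS]hom_val_comp [X in _ * castG _ X]hom_val_comp.
rewrite [RHS]hom_val_comp [X in _ = _ * castG _ X]hom_val_comp.
rewrite !hom_val_eqhom !castG1 !hom_val_tensm !hom_val_braiding /= /juxtapose.
rewrite !mult1 !mul1g !mulg1 castG_block castG_shift_block bshift_block castG_Bw.
exact: BwDr.
Qed.

Fact braid_hexagonV (a b c : braid_monoidal) :
  massocV a b c \; braid_braiding (a \tens b) c \; massocV c a b =
  (idm a \tensm braid_braiding b c) \; massocV a c b \; (braid_braiding a c \tensm idm b).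
Proof.
apply: hom_val_inj.
rewrite [LHS]hom_val_comp [X in _ * castG _ X]hom_val_comp.
rewrite [RHS]hom_val_comp [X in _ = _ * castG _ X]hom_val_comp.
rewrite !hom_val_eqhom !castG1 !hom_val_tensm !hom_val_braiding /= /juxtapose.
rewrite !mult1 !mul1g !mulg1 castG_block castG_shift_block bshift_block ?castG_Bw.
exact: BwDl.
Qed.
End BraidingB.

Definition braid_braided : braided_category :=
  @BraidedCategory braid_monoidal braid_braiding
    (fun a b => coprod_iso (braid_braiding a b))
    braid_braiding_nat braid_hexagon braid_hexagonV.

Lemma mult_conj (G H : groupType) (f : {multiplicative G -> H}) q u :
  f (q * u * q^-1) = f q * f u * (f q)^-1.
Proof. by rewrite !gmulfM multV. Qed.
Lemma mult_conjV (G H : groupType) (f : {multiplicative G -> H}) q u :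
  f (q^-1 * u * q) = (f q)^-1 * f u * f q.
Proof. by rewrite !gmulfM multV. Qed.

Fact strandS_subproof g (i : 'I_g.-1) : (i.+1 < g)%N.
Proof. by rewrite -ltn_predRL. Qed.
Definition strand g (i : 'I_g.-1) : 'I_g := widen_ord (leq_pred g) i.
Definition strandS g (i : 'I_g.-1) : 'I_g := Ordinal (strandS_subproof i).

Section BetaI.
Variables (g : nat) (i : 'I_g.-1).
Implicit Types (z : 'I_g -> pi1 g) (k : 'I_g).
Local Notation lo := (strand i).
Local Notation hi := (strandS i).

Definition betai_gen z k : pi1 g :=
  if k == lo then pR lo * z hi * (pR lo)^-1
  else if k == hi then z lo else z k.

Definition betai_hom : {multiplicative pi1 g -> pi1 g} :=
  pi1_hom (betai_gen (@px g)) (betai_gen (@py g)).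

Definition betaiV_gen z k : pi1 g :=
  if k == lo then z hi
  else if k == hi then (pR hi)^-1 * z lo * pR hi else z k.

Definition betaiV_hom : {multiplicative pi1 g -> pi1 g} :=
  pi1_hom (betaiV_gen (@px g)) (betaiV_gen (@py g)).

Lemma lo_hi : (lo == hi) = false.
Proof. by apply/eqP => /(congr1 val) /=; lia. Qed.

Lemma betai_R k : betai_hom (pR k) = betai_gen (@pR g) k.
Proof.
rewrite mult_comm !pi1_homE /betai_gen.
by case: (k == lo); [rewrite comm_conj | case: (k == hi)].
Qed.

Lemma betaiV_R k : betaiV_hom (pR k) = betaiV_gen (@pR g) k.
Proof.
rewrite mult_comm !pi1_homE /betaiV_gen; case: (k == lo) => //.
by case: (k == hi) => //; rewrite -{2 4}(invgK (pR hi)) comm_conj invgK.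
Qed.

Fact betai_bij : bijective betai_hom.
Proof.
exists betaiV_hom.
  have H z k : (forall j, betaiV_hom (z j) = betaiV_gen z j) ->
      betaiV_hom (betai_gen z k) = z k.
    move=> zE; rewrite /betai_gen; case: (k =P lo) => [->|kl].
      rewrite mult_conj betaiV_R zE /betaiV_gen eqxx eq_sym lo_hi eqxx.
      by move: (pR hi) => A; rewrite !mulgA mulgV mul1g mulgK.
    case: (k =P hi) => [->|kh]; rewrite zE /betaiV_gen ?eqxx //.
    by case: (k =P lo) => // _; case: (k =P hi).
  apply: (@pi1_ext1 _ _ _ betaiV_hom betai_hom idfun) => k; rewrite pi1_homE;
  by apply: H => j; rewrite pi1_homE.
have H z k : (forall j, betai_hom (z j) = betai_gen z j) ->
    betai_hom (betaiV_gen z k) = z k.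
  move=> zE; rewrite /betaiV_gen; case: (k =P lo) => [->|kl].
    by rewrite zE /betai_gen eqxx eq_sym lo_hi.
  case: (k =P hi) => [->|kh]; last first.
    by rewrite zE /betai_gen; case: (k =P lo) => // _; case: (k =P hi).
  rewrite mult_conjV betai_R zE /betai_gen eqxx eq_sym lo_hi eqxx.
  by move: (pR lo) => A; rewrite !mulgA mulVg mul1g mulgVK.
apply: (@pi1_ext1 _ _ _ betai_hom betaiV_hom idfun) => k; rewrite pi1_homE;
by apply: H => j; rewrite pi1_homE.
Qed.

Fact betai_boundary : betai_hom (boundary g) = boundary g.
Proof.
rewrite /boundary mult_prod.
have li := strandS_subproof i.
pose nx (F : 'I_g -> pi1 g) (k : nat) : pi1 g :=
  if (insub k : option 'I_g) is Some j then F j else 1.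
have nxE (F : 'I_g -> pi1 g) : \prod_(k < g) F k = \prod_(0 <= k < g) nx F k.
  by rewrite big_mkord; apply: eq_bigr => k _; rewrite /nx valK.
have nxo F (j : 'I_g) : nx F j = F j by rewrite /nx valK.
rewrite !nxE !(@big_cat_nat _ _ _ i 0 g) //=; try lia.
congr (_ * _).
  apply: eq_big_nat => k /andP[_ ki]; have kg : (k < g)%N by lia.
  rewrite -[k]/(val (Ordinal kg)) !nxo betai_R /betai_gen -!val_eqE /=.
  by case: eqP => [|_]; [lia|]; case: eqP => //; lia.
rewrite !(@big_ltn _ _ _ i) //; try lia; rewrite !(@big_ltn _ _ _ i.+1) //.
rewrite !mulgA; congr (_ * _).
  rewrite -[nat_of_ord i]/(val lo) -[(val lo).+1]/(val hi) !nxo !betai_R.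
  rewrite /betai_gen eqxx eq_sym lo_hi eqxx.
  by move: (pR lo) => A; rewrite mulgVK.
apply: eq_big_nat => k /andP[ik kg].
rewrite -[k]/(val (Ordinal kg)) !nxo betai_R /betai_gen -!val_eqE /=.
by case: eqP => [|_]; [lia|]; case: eqP => //; lia.
Qed.

(* beta_(i+1), for the 0-based index i. *)
Definition betai : mcg g := Mcg betai_bij betai_boundary.

Lemma betai_lo z : (forall k, betai_hom (z k) = betai_gen z k) ->
  betai (z lo) = pR lo * z hi * (pR lo)^-1.
Proof. by move=> zE; rewrite [LHS]zE /betai_gen eqxx. Qed.
Lemma betai_hi z : (forall k, betai_hom (z k) = betai_gen z k) ->
  betai (z hi) = z lo.
Proof. by move=> zE; rewrite [LHS]zE /betai_gen eq_sym lo_hi eqxx. Qed.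
Lemma betai_out z k : (forall k, betai_hom (z k) = betai_gen z k) ->
  k != lo -> k != hi -> betai (z k) = z k.
Proof. by move=> zE /negPf kl /negPf kh; rewrite [LHS]zE /betai_gen kl kh. Qed.
End BetaI.

Section BetaRelations.
Variable g : nat.

Definition handle_like (z : 'I_g -> pi1 g) :=
  forall i k, betai_hom i (z k) = betai_gen i z k.

Lemma handle_x : handle_like (@px g). Proof. by move=> i k; rewrite pi1_homE. Qed.
Lemma handle_y : handle_like (@py g). Proof. by move=> i k; rewrite pi1_homE. Qed.
Lemma handle_R : handle_like (@pR g). Proof. by move=> i k; apply: betai_R. Qed.

Lemma mcg_gen_ext (f h : mcg g) :
  (forall z, handle_like z -> forall k, f (z k) = h (z k)) -> f = h.
Proof.
move=> H; apply: mcg_ext; apply: pi1_ext; apply: H; [exact: handle_x|exact: handle_y].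
Qed.

Lemma mcg_mulE (f h : mcg g) u : (f * h) u = h (f u).
Proof. by []. Qed.

Fact betai_comm (i j : 'I_g.-1) : (i.+1 < j)%N -> betai i * betai j = betai j * betai i.
Proof.
move=> ij; apply: mcg_gen_ext => z zE k; rewrite !mcg_mulE.
have [zi zj] := (zE i, zE j); have [Ri Rj] := (handle_R i, handle_R j).
have n1 : strand i != strand j by rewrite -val_eqE /=; lia.
have n2 : strand i != strandS j by rewrite -val_eqE /=; lia.
have n3 : strandS i != strand j by rewrite -val_eqE /=; lia.
have n4 : strandS i != strandS j by rewrite -val_eqE /=; lia.
have n1' := n1; have n2' := n2; have n3' := n3; have n4' := n4.
rewrite eq_sym in n1'; rewrite eq_sym in n2'; rewrite eq_sym in n3'.
rewrite eq_sym in n4'.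
have [->|k1] := eqVneq k (strand i).
  by rewrite (betai_out zj) // !(betai_lo zi) mult_conj !(betai_out Rj) // !(betai_out zj).
have [->|k2] := eqVneq k (strandS i).
  by rewrite (betai_out zj) // !(betai_hi zi) (betai_out zj).
have [->|k3] := eqVneq k (strand j).
  by rewrite (betai_out zi) // !(betai_lo zj) mult_conj !(betai_out Ri) // !(betai_out zi).
have [->|k4] := eqVneq k (strandS j).
  by rewrite (betai_out zi) // !(betai_hi zj) (betai_out zi).
by rewrite !(betai_out zi, betai_out zj).
Qed.

Fact betai_braid (i j : 'I_g.-1) : j = i.+1 :> nat ->
  betai i * betai j * betai i = betai j * betai i * betai j.
Proof.
move=> ij; apply: mcg_gen_ext => z zE k; rewrite !mcg_mulE.
have [zi zj] := (zE i, zE j); have [Ri Rj] := (handle_R i, handle_R j).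
have e : strandS i = strand j by apply: val_inj.
have n1 : strand i != strand j by rewrite -val_eqE /=; lia.
have n2 : strand i != strandS j by rewrite -val_eqE /=; lia.
have n4 : strandS j != strandS i by rewrite -val_eqE /=; lia.
have n5 : strandS j != strand i by rewrite -val_eqE /=; lia.
have zih : betai i (z (strand j)) = z (strand i) by rewrite -e (betai_hi zi).
have Rih : betai i (pR (strand j)) = pR (strand i) by rewrite -e (betai_hi Ri).
have zil := betai_lo zi; have Ril := betai_lo Ri; rewrite e in zil Ril.
have zjl := betai_lo zj; have zjh := betai_hi zj.
have Rjl := betai_lo Rj; have Rjh := betai_hi Rj.
have zjo : betai j (z (strand i)) = z (strand i) by apply: (betai_out zj).
have Rjo : betai j (pR (strand i)) = pR (strand i) by apply: (betai_out Rj).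
have zio : betai i (z (strandS j)) = z (strandS j) by apply: (betai_out zi).
have [->|k1] := eqVneq k (strand i).
  rewrite zil zjo zil !mult_conj zjl Rjo !mult_conj Ril Rih zio.
  move: (pR _) (pR _) (z _) => A B C.
  by rewrite !invgM !invgK !mulgA !mulgVK.
have [->|k2] := eqVneq k (strand j).
  by rewrite zih zjo zil zjl mult_conj zio Rih mult_conj zjh Rjo.
have [->|k3] := eqVneq k (strandS j).
  by rewrite zio zjh zih zjo.
by rewrite !(betai_out zi, betai_out zj) // e.
Qed.
End BetaRelations.

Definition phi (g : nat) : {multiplicative braid_group g -> mcg g} :=
  braid_hom (@betai_comm g) (@betai_braid g).

Lemma phi_sigma g (i : 'I_g.-1) : phi g (sigma i) = betai i.
Proof. exact: braid_hom_sigma. Qed.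

(* Main.v *)
From HB Require Import structures.
Require Import Defs.
From mathcomp Require Import all_boot.
From mathcomp Require Import zify.

Set Implicit Arguments.
Unset Strict Implicit.
Unset Printing Implicit Defensive.

Local Open Scope group_scope.

(* Number the handles from 0 and let D_k = sigma_(k+r) ... sigma_(k+1), so that
   sigma_(r,s) is the product D_0 ... D_(s-1). On generators, D_k carries the
   handle k + r back to k and moves each handle j with k <= j < k + r to j + 1,
   conjugated by R_k. Applying D_0, ..., D_(s-1) in turn moves the first r handles
   s places to the right and conjugates them by R_0 ... R_(s-1) = Q, and carries
   the last s handles to the front unchanged: this is beta_(r,s). Monoidality only
   has to be checked on the generators sigma_i of each factor. *)

Lemma conjhM (G : groupType) (p q u : G) : conjh (p * q) u = conjh p (conjh q u).
Proof. by rewrite /conjh invgM !mulgA. Qed.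

Lemma conjh_mult (G H : groupType) (f : {multiplicative G -> H}) q u :
  f (conjh q u) = conjh (f q) (f u).
Proof. exact: mult_conj. Qed.

(** * Action of braid words on the handles *)

Section Handles.
Variable n : nat.
Implicit Types (z : 'I_n -> pi1 n) (f : {multiplicative pi1 n -> pi1 n}).

(** Indexing by [nat], with value 1 out of range as for [sg], leaves plain arithmetic for [lia]. *)
Definition handle z (k : nat) : pi1 n :=
  if (insub k : option 'I_n) is Some i then z i else 1.

Lemma handleE z (i : 'I_n) : handle z i = z i.
Proof. by rewrite /handle valK. Qed.

Lemma handle_out z k : (n <= k)%N -> handle z k = 1.
Proof. by move=> nk; rewrite /handle insubF //; lia. Qed.

Lemma phi_sg z k j : handle_like z -> (k.+1 < n)%N ->
  phi n (sg n k) (handle z j) =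
    if j == k then conjh (handle (@pR n) k) (handle z k.+1)
    else if j == k.+1 then handle z k else handle z j.
Proof.
move=> zE kn; have lk : (k < n.-1)%N by lia.
have [nj|jn] := leqP n j.
  rewrite (handle_out _ nj) mult1.
  by case: eqP => [|_]; [lia|]; case: eqP => [|_]; [lia|].
rewrite -[k]/(val (Ordinal lk)) -sgE phi_sigma; set i := Ordinal lk.
rewrite -[j]/(val (Ordinal jn)) -[val i]/(val (strand i)).
rewrite -[(val (strand i)).+1]/(val (strandS i)) !handleE.
by rewrite [LHS]zE.
Qed.

(** Induction on [r]: the top generator acts first. Keeping [z] general lets the induction
    hypothesis apply to the conjugating elements [pR] as well. *)
Lemma phi_Dw z k r j : handle_like z -> (k + r < n)%N ->
  phi n (Dw n k r) (handle z j) =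
    if (k <= j < k + r)%N then conjh (handle (@pR n) k) (handle z j.+1)
    else if j == (k + r)%N then handle z k else handle z j.
Proof.
elim: r z j => [|r ih] z j zE kn.
  rewrite Dw0 mult1 addn0; have -> : (k <= j < k)%N = false by lia.
  by case: eqP => [->|].
have kn' : (k + r < n)%N by lia.
rewrite DwS gmulfM mcg_mulE phi_sg -?[(k + r).+1]addnS //.
case: (j =P (k + r)%N) => [->|jr].
  (* The first factor conjugates by R_(k+r), which the remaining factors carry to R_k; they fix
     handle k+r+1. *)
  rewrite conjh_mult (ih (@pR n)) ?ih //; last exact: handle_R.
  have -> : (k <= k + r < k + r)%N = false by lia.
  have -> : (k <= k + r.+1 < k + r)%N = false by lia.
  have -> : (k <= k + r < k + r.+1)%N by lia.
  by rewrite eqxx eqn_add2l (gtn_eqF (ltnSn r)) addnS.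
case: (j =P (k + r.+1)%N) => [->|jr'].
  rewrite ih //; have -> : (k <= k + r < k + r)%N = false by lia.
  have -> : (k <= k + r.+1 < k + r.+1)%N = false by lia.
  by rewrite eqxx.
rewrite ih //; have -> : (j == k + r)%N = false by apply/eqP.
by have -> : (k <= j < k + r.+1)%N = (k <= j < k + r)%N by lia.
Qed.

(** Induction on [s] with [n] fixed: the last branch says that handle r+s stays in place until D_s
    is applied. *)
Lemma phi_Bw z r s j : handle_like z -> (r + s <= n)%N ->
  phi n (Bw n 0 r s) (handle z j) =
    if (j < r)%N then conjh (\prod_(i < s) handle (@pR n) i) (handle z (s + j))
    else if (j < r + s)%N then handle z (j - r) else handle z j.
Proof.
move=> zE; elim: s => [|s ih] sn.
  rewrite /Bw !big_ord0 mult1 add0n /conjh invg1 mul1g mulg1 addn0.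
  by case: ltnP.
have sn' : (r + s <= n)%N by lia.
have Dn : (s + r < n)%N by lia.
rewrite BwS add0n gmulfM mcg_mulE ih //; case: ltnP => jr.
  (* D_s fixes R_0, ..., R_(s-1) and adds a conjugation by R_s, so the conjugators multiply to R_0
     ... R_s. *)
  rewrite conjh_mult mult_prod phi_Dw // big_ord_recr conjhM /=.
  have -> : (s <= s + j < s + r)%N by lia.
  congr (conjh _ _); apply: eq_bigr => i _; rewrite phi_Dw //; last exact: handle_R.
  have lti := ltn_ord i; have -> : (s <= i < s + r)%N = false by lia.
  by case: eqP => //; lia.
case: (ltngtP j (r + s)%N) => jrs.
- have -> : (j < r + s.+1)%N by lia.
  rewrite phi_Dw //; have -> : (s <= j - r < s + r)%N = false by lia.
  by case: eqP => //; lia.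
- have -> : (j < r + s.+1)%N = false by lia.
  rewrite phi_Dw //; have -> : (s <= j < s + r)%N = false by lia.
  by case: eqP => //; lia.
(* This is the handle that D_s itself brings from s+r to s. *)
- have -> : (j < r + s.+1)%N by lia.
  rewrite phi_Dw //; have -> : (s <= j < s + r)%N = false by lia.
  by rewrite jrs addnC eqxx addnK.
Qed.
End Handles.

Lemma betaQ_handle r s : betaQ r s = \prod_(i < s) handle (@pR (r + s)) i.
Proof. by apply: eq_bigr => i _; rewrite -handleE. Qed.

(** This is [phi_Bw] at n = r+s, where its last branch is void; [castC] preserves the numerical
    index. *)
Lemma phi_sigma_block r s : phi (r + s) (sigma_block r s) = beta r s.
Proof.
have H z : handle_like z -> forall k,
    phi (r + s) (sigma_block r s) (z k) = beta_gen z k.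
  move=> zE k; rewrite -handleE sigma_blockE phi_Bw // /beta_gen.
  rewrite -{1 2 3 4}(splitK k); case: (split k) => i /=.
    by rewrite ltn_ord betaQ_handle -[z _]handleE.
  rewrite ltnNge leq_addr /= ltn_add2l ltn_ord addKn.
  by rewrite -[RHS]handleE.
apply: mcg_ext; apply: pi1_ext => k /=; rewrite pi1_homE; apply: H.
  exact: handle_x.
exact: handle_y.
Qed.

(** * Compatibility with the monoidal products *)

Section BetaMap.
Variables (m n : nat) (s : 'I_m -> 'I_n) (j : 'I_n.-1).

(** Injectivity of [s] makes the case distinctions of both [betai_gen] agree. Below, [s] includes
    the factor containing the two strands, and in [betai_map_id] the other factor. *)
Lemma betai_map (i : 'I_m.-1) u : injective s ->
  s (strand i) = strand j -> s (strandS i) = strandS j ->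
  betai_hom j (pi1_map s u) = pi1_map s (betai_hom i u).
Proof.
move=> s_inj lo hi.
have H z z' k : (forall k, z' (s k) = pi1_map s (z k)) ->
    betai_gen j z' (s k) = pi1_map s (betai_gen i z k).
  move=> zE; rewrite /betai_gen -lo -hi !(inj_eq s_inj) !zE -pi1_map_R.
  by case: eqP => _; [rewrite mult_conj | case: eqP].
by apply: pi1_ext2 u => k; rewrite pi1_mapE !pi1_homE; apply: H => l;
  rewrite pi1_mapE.
Qed.

Lemma betai_map_id u : (forall k, s k != strand j) -> (forall k, s k != strandS j) ->
  betai_hom j (pi1_map s u) = pi1_map s u.
Proof.
move=> lo hi; apply: pi1_ext1 u => k; rewrite pi1_mapE pi1_homE /betai_gen;
by rewrite (negPf (lo k)) (negPf (hi k)).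
Qed.
End BetaMap.

Section Juxtaposition.
Variables m n : nat.

(** As homomorphisms, [fprodl] and [fprodr] can be compared with [bshift] on the generators alone,
    by [braid_ext]. *)
Definition fprodl (x : mcg m) : mcg (m + n) := Defs.fprod x 1.
Fact fprodl_morph : {morph fprodl : x y / x * y}.
Proof. by move=> x y; rewrite /fprodl -fprodM mulg1. Qed.
HB.instance Definition _ :=
  isMultiplicative.Build (mcg m) (mcg (m + n)) fprodl fprodl_morph.

Definition fprodr (y : mcg n) : mcg (m + n) := Defs.fprod 1 y.
Fact fprodr_morph : {morph fprodr : x y / x * y}.
Proof. by move=> x y; rewrite /fprodr -fprodM mulg1. Qed.
HB.instance Definition _ :=
  isMultiplicative.Build (mcg n) (mcg (m + n)) fprodr fprodr_morph.

Lemma phi_bshiftl (le : (0 + m <= m + n)%N) a :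
  phi (m + n) (bshift le a) = fprodl (phi m a).
Proof.
apply: (@braid_ext m _ (phi (m + n) \o bshift le) (fprodl \o phi m)) => i /=.
rewrite bshift_sigma !phi_sigma; apply: mcg_ext; apply: pi1_ext_split => u /=.
  rewrite fprod_hom_l; apply: betai_map; first exact: lshift_inj.
    exact: val_inj.
  exact: val_inj.
by rewrite fprod_hom_r betai_map_id // => k; rewrite -val_eqE /=;
  have := ltn_ord i; lia.
Qed.

Lemma phi_bshiftr (le : (m + n <= m + n)%N) b :
  phi (m + n) (bshift le b) = fprodr (phi n b).
Proof.
apply: (@braid_ext n _ (phi (m + n) \o bshift le) (fprodr \o phi n)) => i /=.
rewrite bshift_sigma !phi_sigma; apply: mcg_ext; apply: pi1_ext_split => u /=.
  by rewrite fprod_hom_l betai_map_id // => k; rewrite -val_eqE /=;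
    have := ltn_ord k; lia.
rewrite fprod_hom_r; apply: betai_map; first exact: rshift_inj.
  exact: val_inj.
by apply: val_inj; rewrite /= addnS.
Qed.

Lemma phi_juxtapose (a : braid_group m) (b : braid_group n) :
  phi (m + n) (juxtapose a b) = Defs.fprod (phi m a) (phi n b).
Proof.
rewrite /juxtapose gmulfM phi_bshiftl phi_bshiftr /fprodl /fprodr -fprodM.
by rewrite mulg1 mul1g.
Qed.
End Juxtaposition.

(** * The braided monoidal functor *)

Definition Phi_mor a b (f : @hom braid_braided a b) : @hom mcg_braided a b :=
  match f in coprod_hom _ a b return @hom mcg_braided a b with
  | EndHom n x => EndHom (phi n x)
  end.

Lemma Phi_mor_comp a b c (f : @hom braid_braided a b) (g : @hom braid_braided b c) :
  Phi_mor (compm f g) = compm (Phi_mor f) (Phi_mor g).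
Proof. by case: f g => n x g; case: g x => k y x; rewrite /= gmulfM. Qed.

(** Associators, unitors and the cast inside each braiding are all of the form [eqhom]. *)
Lemma Phi_mor_eqhom a b (e : a = b) :
  Phi_mor (@eqhom braid_group a b e) = @eqhom mcg a b e.
Proof. by case: b / e; rewrite /= mult1. Qed.

Lemma Phi_mor_tens a b c d (f : @hom braid_braided a b) (g : @hom braid_braided c d) :
  Phi_mor (tensm f g) = tensm (Phi_mor f) (Phi_mor g).
Proof. by case: f => n x; case: g => k y; rewrite /= phi_juxtapose. Qed.

Lemma idm_iso (C : category) (a : C) : is_iso (idm a).
Proof. by exists (idm a); split; rewrite comp1m. Qed.

Definition Phi_functor : functor_on (fun g : braid_braided => g : mcg_braided) :=
  @FunctorOn braid_braided mcg_braided _ Phi_mor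
    (fun a => Phi_mor_eqhom (erefl a)) Phi_mor_comp.

(** The functor is strict. [Defined] keeps [Fmu] and [Feps] transparent, so that they compute to
    identities in the theorem. *)
Definition Phi_monoidal : monoidal_functor_on (fun g : braid_braided => g : mcg_braided).
Proof.
apply: (@MonoidalFunctorOn _ _ _ Phi_functor
  (fun a b => idm (tens (a : mcg_braided) b)) (idm (munit : mcg_braided))).
- by move=> a b; apply: idm_iso.
- exact: idm_iso.
- by move=> a b a' b' f g; rewrite compm1 comp1m -Phi_mor_tens.
- move=> a b c; rewrite !tensm1 !comp1m compm1.
  exact: Phi_mor_eqhom.
- by move=> a; rewrite !tensm1 !comp1m; apply: Phi_mor_eqhom.
- by move=> a; rewrite !tensm1 !comp1m; apply: Phi_mor_eqhom.
Defined.

Lemma Phi_braiding (r s : braid_braided) :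
  Phi_mor (braiding r s) = braiding (r : mcg_braided) s.
Proof.
by rewrite [LHS]Phi_mor_comp Phi_mor_eqhom /= phi_sigma_block.
Qed.

Theorem theorem3p8 :
  exists Phi : @braided_functor_on braid_braided mcg_braided (fun g : nat => g),
    [/\ forall (g : nat) (b : braid_group g),
          Fmor Phi (EndHom b : @hom braid_braided g g) = EndHom (phi g b),
        forall r s : braid_braided, Fmu Phi r s = idm (tens (r : mcg_braided) s)
      & Feps Phi = idm (munit : mcg_braided)].
Proof.
have PhiB (r s : braid_braided) :
    compm (Fmu Phi_monoidal r s) (Fmor Phi_monoidal (braiding r s)) =
    compm (braiding (r : mcg_braided) s) (Fmu Phi_monoidal s r).
  exact: etrans (comp1m _) (etrans (Phi_braiding r s) (esym (compm1 _))).
by exists (BraidedFunctorOn PhiB).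
Qed.
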